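(* Let $q\ge3$, and let $a$ be a root of the Hamming graph $H(d,q)$. For $d\ge2$, as real algebras, $$\mathcal B_a(H(d,q))\cong M_d(\mathbb R)\oplus M_d(\mathbb R)\oplus M_{d-1}(\mathbb R)\oplus\mathbb R^{d-1}.$$ For $d=1$ it is $\mathbb R\oplus\mathbb R$. In particular, $$\dim\mathcal B_a(H(d,q))=3d^2-d\qquad(d\ge1).$$ For all $d\ge1$, the compressed Terwilliger algebra is $$e\mathcal T(a)e\cong M_d(\mathbb R)\oplus\bigoplus_{\substack{0\le r\le d,\ 0\le j\le\lfloor(d-r)/2\rfloor\\ (r,j)\ne(0,0)}}M_{d-r-2j+1}(\mathbb R).$$ Consequently, among all Hamming graphs $H(d,q)$ with $d\ge1$, $q\ge2$, $$\mathcal B_a(H(d,q))=e\mathcal T(a)e\quad\Longleftrightarrow\quad\begin{cases}d\le4,&q=2,\\ d\le2,&q\ge3.\end{cases}$$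
   Context: All algebras are over $\mathbb R$; $\langle\cdots\rangle$ denotes the real unital algebra generated. $H(d,q)=K_q^{\square d}$ is the $d$-fold Cartesian power of the complete graph $K_q$ (for $q=2$ it is the hypercube $Q_d$). For a finite simple connected regular graph $G$ with at least two vertices and $a\in V(G)$: $B=A(G-a)$ is the adjacency matrix of the vertex-deleted graph, $E$ is the diagonal matrix indexed by $V(G)\setminus\{a\}$ whose diagonal is the indicator of the neighbourhood $N(a)$, and $\mathcal B_a=\mathcal B_a(G)=\langle I,B,E\rangle$. With $A$ the adjacency matrix of $G$, $D$ the eccentricity of $a$, and $E_i^*$ the diagonal projection of $\mathbb R^{V(G)}$ onto the vertices at distance $i$ from $a$, the Terwilliger algebra is $\mathcal T(a)=\langle A,E_0^*,\ldots,E_D^*\rangle$. Put $e=I-E_0^*$; the corner (compressed Terwilliger algebra) $e\mathcal T(a)e$ is identified with an algebra of operators on $\mathbb R^{V(G)\setminus\{a\}}$. Empty direct sums are omitted. *)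

(* Defs.v *)
From HB Require Import structures.
From mathcomp Require Import all_boot all_order all_algebra.
From mathcomp Require Import boolp classical_sets reals.
Set Implicit Arguments.
Unset Strict Implicit.
Unset Printing Implicit Defensive.
Import GRing.Theory.
Local Open Scope ring_scope.
Local Open Scope classical_set_scope.

(* Direct sum of full matrix algebras of sizes m i, i : I, with pointwise
   operations; the library only provides the non-dependent case. *)
Definition mxsum (R : Type) (I : finType) (m : I -> nat) :=
  {dffun forall i : I, 'M[R]_(m i)}.

Section MxSum.
Variables (R : comPzRingType) (I : finType) (m : I -> nat).
Local Notation T := (mxsum R m).
Implicit Types x y z : T.

HB.instance Definition _ := Choice.on T.

Definition mxsum_zero : T := [ffun i => 0].
Definition mxsum_opp x : T := [ffun i => - x i].
Definition mxsum_add x y : T := [ffun i => x i + y i].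
Definition mxsum_one : T := [ffun i => 1%:M].
Definition mxsum_mul x y : T := [ffun i => x i *m y i].
Definition mxsum_scale (c : R) x : T := [ffun i => c *: x i].

Fact mxsum_addA : associative mxsum_add.
Proof. by move=> x y z; apply/ffunP => i; rewrite !ffunE addrA. Qed.
Fact mxsum_addC : commutative mxsum_add.
Proof. by move=> x y; apply/ffunP => i; rewrite !ffunE addrC. Qed.
Fact mxsum_add0 : left_id mxsum_zero mxsum_add.
Proof. by move=> x; apply/ffunP => i; rewrite !ffunE add0r. Qed.
Fact mxsum_addN : left_inverse mxsum_zero mxsum_opp mxsum_add.
Proof. by move=> x; apply/ffunP => i; rewrite !ffunE addNr. Qed.

HB.instance Definition _ :=
  GRing.isZmodule.Build T mxsum_addA mxsum_addC mxsum_add0 mxsum_addN.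

Fact mxsum_mulA : associative mxsum_mul.
Proof. by move=> x y z; apply/ffunP => i; rewrite !ffunE mulmxA. Qed.
Fact mxsum_mul1l : left_id mxsum_one mxsum_mul.
Proof. by move=> x; apply/ffunP => i; rewrite !ffunE mul1mx. Qed.
Fact mxsum_mul1r : right_id mxsum_one mxsum_mul.
Proof. by move=> x; apply/ffunP => i; rewrite !ffunE mulmx1. Qed.
Fact mxsum_mulDl : left_distributive mxsum_mul +%R.
Proof. by move=> x y z; apply/ffunP => i; rewrite !ffunE mulmxDl. Qed.
Fact mxsum_mulDr : right_distributive mxsum_mul +%R.
Proof. by move=> x y z; apply/ffunP => i; rewrite !ffunE mulmxDr. Qed.

HB.instance Definition _ := GRing.Zmodule_isPzRing.Build T
  mxsum_mulA mxsum_mul1l mxsum_mul1r mxsum_mulDl mxsum_mulDr.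

Fact mxsum_scaleA b c x :
  mxsum_scale b (mxsum_scale c x) = mxsum_scale (b * c) x.
Proof. by apply/ffunP => i; rewrite !ffunE scalerA. Qed.
Fact mxsum_scale1 : left_id 1 mxsum_scale.
Proof. by move=> x; apply/ffunP => i; rewrite !ffunE scale1r. Qed.
Fact mxsum_scaleDr : right_distributive mxsum_scale +%R.
Proof. by move=> c x y; apply/ffunP => i; rewrite !ffunE scalerDr. Qed.
Fact mxsum_scaleDl x : {morph mxsum_scale^~ x : b c / b + c}.
Proof. by move=> b c; apply/ffunP => i; rewrite !ffunE scalerDl. Qed.

HB.instance Definition _ := GRing.Zmodule_isLmodule.Build R T
  mxsum_scaleA mxsum_scale1 mxsum_scaleDr mxsum_scaleDl.

End MxSum.

Definition is_subalgebra (R : realType) (n : nat) (S : set 'M[R]_n) : Prop :=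
  [/\ S 1%:M,
      forall (c : R) (M N : 'M[R]_n), S M -> S N -> S (c *: M + N) &
      forall M N : 'M[R]_n, S M -> S N -> S (M *m N)].

Definition gen_alg (R : realType) (n : nat) (X : set 'M[R]_n) : set 'M[R]_n :=
  smallest (@is_subalgebra R n) X.

(* [alg_iso S A]: the unital subalgebra S of a matrix algebra is isomorphic to
   the algebra A.  A notation, because matrix algebras of size possibly 0 carry
   the library's ring and module structures but no algebra structure, so A
   cannot be a single structure argument. *)
Notation alg_iso S A :=
  (exists f : A -> _,
    [/\ range f = S, injective f, linear f & GRing.monoid_morphism f]).

Definition has_dim (R : realType) (n : nat) (S : set 'M[R]_n) (k : nat) : Prop :=
  exists2 W : {vspace 'M[R]_n}, S = [set M | M \in W] & \dim W = k.

Section Graph.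
(* A graph on V is given by its adjacency relation; matrices indexed by V are
   indexed by 'I_#|V| through enum_val. *)
Variables (R : realType) (V : finType) (e : rel V).

Definition adjmx : 'M[R]_#|V| :=
  \matrix_(i, j) (e (enum_val i) (enum_val j))%:R.

Definition diagmx (P : pred V) : 'M[R]_#|V| :=
  diag_mx (\row_i (P (enum_val i))%:R).

(* Length of a shortest walk from x to y (#|V| if there is none). *)
Definition gdist (x y : V) : nat :=
  find (fun k => [exists p : k.-tuple V, path e x p && (last x p == y)])
       (iota 0 #|V|).

Definition eccentricity (a : V) : nat := \max_(x : V) gdist a x.

Definition Estar (a : V) (i : nat) : 'M[R]_#|V| :=
  diagmx (fun x => gdist a x == i).

Definition terwilliger (a : V) : set 'M[R]_#|V| :=
  gen_alg [set M | M = adjmx \/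
                   exists2 i, (i <= eccentricity a)%N & M = Estar a i].

End Graph.
Arguments terwilliger : clear implicits.

Definition vdel (V : finType) (a : V) : finType := {x : V | x != a}.

Definition edel (V : finType) (e : rel V) (a : V) : rel (vdel a) :=
  fun x y => e (val x) (val y).
Arguments edel {V} e a.

Definition Balg (R : realType) (V : finType) (e : rel V) (a : V) :
    set 'M[R]_#|vdel a| :=
  gen_alg [set M | M = adjmx R (edel e a) \/
                   M = diagmx R (fun x : vdel a => e a (val x))].

(* Restriction of a matrix indexed by V to the rows and columns other than a;
   this is the identification of e T(a) e with operators on R^(V - a). *)
Definition compress (R : realType) (V : finType) (a : V) (M : 'M[R]_#|V|) :
    'M[R]_#|vdel a| :=
  let f (i : 'I_#|vdel a|) : 'I_#|V| := enum_rank (val (enum_val i)) in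
  mxsub f f M.

Definition corner (R : realType) (V : finType) (e : rel V) (a : V) :
    set 'M[R]_#|vdel a| :=
  let E := 1%:M - Estar R e a 0 in
  [set compress a (E *m M *m E) | M in terwilliger R V e a].
Arguments Balg R {V} e a.
Arguments corner R {V} e a.

Definition cart_power (U : finType) (e : rel U) (d : nat) :
    rel {ffun 'I_d -> U} :=
  fun x y => [exists i, e (x i) (y i) && [forall j, (j != i) ==> (x j == y j)]].

Definition hamming (d q : nat) : rel {ffun 'I_d -> 'I_q} :=
  @cart_power 'I_q (fun u v => u != v) d.
Arguments hamming : clear implicits.

Definition corner_index (d : nat) : finType :=
  {p : 'I_d.+1 * 'I_d.+1 |
    (p.2 <= (d - p.1)./2)%N && (p != (ord0, ord0))}.

Definition corner_size (d : nat) (p : corner_index d) : nat :=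
  let: (r, j) := val p in (d - r - 2 * j + 1)%N.
Arguments corner_size : clear implicits.

(* Main.v *)
From HB Require Import structures.
From mathcomp Require Import all_boot all_order all_algebra.
From mathcomp Require Import boolp classical_sets reals.
From mathcomp Require Import fingroup perm.
From mathcomp Require Import zify ring lra.
Require Import Defs.

(** Let the root be a, and let R^V be the d-fold tensor power of R^q. The vectors delta_a and u
    (the indicator of the q - 1 other letters) span a plane stable under A(K_q), and A(K_q) is
    -1 on the space Z of the zero-sum vectors supported on the other letters. Expanding the
    tensor power and splitting the powers of the plane into symmetric powers, R^V becomes a sum
    of irreducible modules of the Terwilliger algebra T(a), of types (r, j): r positions carry
    a vector of Z, j pairs of positions are antisymmetrised, and the m = d - r - 2j others
    carry the m-th symmetric power of the plane. Such a module has a basis v_0, ..., v_m, with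
    v_k supported at distance r + j + k from a, on which A is tridiagonal with nonzero off-
    diagonal entries [block_adj]. For q = 2 one has Z = 0, so only r = 0 occurs.

    A full decomposition of R^V is avoided. One module of each type is written down
    [ex_intertwiner], which gives a homomorphism rho from T(a) to the direct sum of the matrix
    algebras M_(m+1). It is onto: among the modules starting at distance w, the values of A at
    the lowest vectors are distinct, so these lowest vectors can be isolated from the E_w^*,
    and an irreducible tridiagonal matrix together with one diagonal matrix unit generates the
    whole block [units_of_weights, tridiag_krylov]. It is injective by counting: matrices in
    T(a) commute with the isometries fixing a, so they are constant on the orbits of pairs of
    vertices [invariant_orbit_span], and there are at most C(d+4, 4) such orbits (C(d+3, 3) for
    q = 2), which is the sum of the (m + 1)^2 [sum_bsize_sq]. So T(a) has a system of matrix
    units [terwilliger_units], and compressing removes the first basis vector of the type (0,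
    0) only, which gives the corner [corner_units].

    The algebra B_a is generated in the corner by A and E_1^*. The types with r + j <= 1 are
    those that meet the neighbourhood of a; on each of them E = E_1^* is a rank one idempotent,
    and the value of E A^2 E + 4 E A E there tells them apart, so B_a contains their full
    matrix algebras, of sizes d, d and d - 1 for the types (0, 0), (1, 0) (if q >= 3) and (0,
    1) [near_root_units]. On the other types E vanishes, so B_a acts through polynomials in A,
    whose eigenvalues there are qt - d with j <= t <= d - r - j [mx_eval_block_eq0]. For q >= 3
    the type (2, 0) already has all the eigenvalues t = 0, ..., d - 2 that occur, and each of
    them contributes one summand R [Bunit_system, range_Bunit].

    Finally B_a acts on a far type through commuting matrices. So it is smaller than the corner
    as soon as a far type has dimension at least 2, which happens for (0, 2) when q = 2 and d
    >= 5, and for (2, 0) when q >= 3 and d >= 3; in the remaining cases there is at most one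
    far type, of dimension 1, and its unit is obtained by subtracting the others from the
    identity [Balg_neq_corner, Balg_eq_corner]. *)

Set Implicit Arguments.
Unset Strict Implicit.
Unset Printing Implicit Defensive.
Import Order.TTheory GRing.Theory Num.Theory.
Local Open Scope ring_scope.

(** * Matrix units in a direct sum of matrix algebras *)

Section MxUnits.
Variables (R : fieldType) (P : finType) (s : P -> nat).
Local Notation T := (mxsum R s).

(** The indices k and l are natural numbers rather than elements of 'I_(s p), so that units of
    different blocks can be compared and shifted; the unit is 0 when k or l is out of range. *)
Definition munit (p : P) (k l : nat) : T :=
  [ffun p' => \matrix_(i, j) ((p' == p) && (i == k :> nat) && (j == l :> nat))%:R].

Lemma munitE p k l p' (i j : 'I_(s p')) :
  munit p k l p' i j = ((p' == p) && (i == k :> nat) && (j == l :> nat))%:R.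
Proof. by rewrite ffunE mxE. Qed.

Lemma mxsumP (x y : T) :
  (forall p (i j : 'I_(s p)), x p i j = y p i j) -> x = y.
Proof. by move=> h; apply/ffunP => p; apply/matrixP => i j. Qed.

Lemma mxsumDE (x y : T) p : (x + y) p = x p + y p.
Proof. by rewrite ffunE. Qed.
Lemma mxsumZE c (x : T) p : (c *: x) p = c *: x p.
Proof. by rewrite ffunE. Qed.
Lemma mxsumME (x y : T) p : (x * y) p = x p *m y p.
Proof. by rewrite ffunE. Qed.
Lemma mxsum1E p : (1 : T) p = 1%:M.
Proof. by rewrite ffunE. Qed.
Lemma mxsum0E p : (0 : T) p = 0.
Proof. by rewrite ffunE. Qed.
Lemma mxsumNE (x : T) p : (- x) p = - x p.
Proof. by rewrite ffunE. Qed.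
Lemma mxsum_sumE (I : Type) (r : seq I) (Q : pred I) (F : I -> T) p :
  (\sum_(i <- r | Q i) F i) p = \sum_(i <- r | Q i) F i p.
Proof.
by apply: (big_morph (fun x : T => x p)) => [x y|]; rewrite ?mxsumDE ?mxsum0E.
Qed.
Lemma mxsum_scalerAl c (x y : T) : c *: (x * y) = (c *: x) * y.
Proof. by apply/ffunP => p; rewrite !ffunE scalemxAl. Qed.
Lemma mxsum_scalerAr c (x y : T) : c *: (x * y) = x * (c *: y).
Proof. by apply/ffunP => p; rewrite !ffunE scalemxAr. Qed.

Lemma mxsumDe (x y : T) p i j : (x + y) p i j = x p i j + y p i j.
Proof. by rewrite mxsumDE mxE. Qed.
Lemma mxsumBe (x y : T) p i j : (x - y) p i j = x p i j - y p i j.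
Proof. by rewrite mxsumDE mxsumNE !mxE. Qed.
Lemma mxsumZe c (x : T) p i j : (c *: x) p i j = c * x p i j.
Proof. by rewrite mxsumZE mxE. Qed.
Lemma mxsum_sume (I : Type) (r : seq I) (Q : pred I) (F : I -> T) p i j :
  (\sum_(t <- r | Q t) F t) p i j = \sum_(t <- r | Q t) F t p i j.
Proof. by rewrite mxsum_sumE summxE. Qed.

Lemma mul_munit p k l (x : T) p' (i j : 'I_(s p')) (hl : (l < s p')%N) :
  (munit p k l * x) p' i j =
  ((p' == p) && (i == k :> nat))%:R * x p' (Ordinal hl) j.
Proof.
rewrite mxsumME mxE (bigD1 (Ordinal hl)) //= big1 ?addr0 => [|i' ne].
  by rewrite munitE /= eqxx andbT.
rewrite munitE; have /negbTE -> : i' != l :> nat by apply: contra ne => /eqP e; apply/eqP/val_inj.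
by rewrite andbF mul0r.
Qed.

Lemma mulx_munit p k l (x : T) p' (i j : 'I_(s p')) (hk : (k < s p')%N) :
  (x * munit p k l) p' i j =
  ((p' == p) && (j == l :> nat))%:R * x p' i (Ordinal hk).
Proof.
rewrite mxsumME mxE (bigD1 (Ordinal hk)) //= big1 ?addr0 => [|i' ne].
  by rewrite munitE /= eqxx andbT mulrC.
rewrite munitE; have /negbTE -> : i' != k :> nat by apply: contra ne => /eqP e; apply/eqP/val_inj.
by rewrite andbF mulr0.
Qed.

Lemma munitM p k l p' k' l' : (l < s p)%N ->
  munit p k l * munit p' k' l' = ((p == p') && (l == k'))%:R *: munit p k l'.
Proof.
move=> hl; apply: mxsumP => p1 i j; rewrite mxsumZE [RHS]mxE munitE.
case: (eqVneq p1 p) => [e|ne]; last first.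
  rewrite mulr0 mxsumME mxE big1 // => i' _; rewrite munitE.
  by rewrite (negbTE ne) mul0r.
subst p1; rewrite (mul_munit _ _ _ _ _ hl) munitE /= eqxx /=.
by case: (_ == p'); case: (_ == k'); case: (_ == k); case: (_ == l');
   rewrite /= ?mulr0 ?mul0r ?mulr1.
Qed.

Lemma mxsum_decomp (x : T) :
  x = \sum_p \sum_(k < s p) \sum_(l < s p) x p k l *: munit p k l.
Proof.
apply: mxsumP => p i j; rewrite mxsum_sumE summxE (bigD1 p) //= [X in _ + X]big1; last first.
  move=> p' ne; rewrite mxsum_sumE summxE big1 // => k _.
  rewrite mxsum_sumE summxE big1 // => l _.
  by rewrite mxsumZE mxE munitE eq_sym (negbTE ne) mulr0.
rewrite addr0 mxsum_sumE summxE (bigD1 i) //= [X in _ + X]big1; last first.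
  move=> k ne; rewrite mxsum_sumE summxE big1 // => l _.
  by rewrite mxsumZE mxE munitE eqxx /= [i == _ :> nat]eq_sym (inj_eq (@ord_inj _)) (negbTE ne)
    mulr0.
rewrite addr0 mxsum_sumE summxE (bigD1 j) //= [X in _ + X]big1; last first.
  move=> l ne.
  by rewrite mxsumZE mxE munitE !eqxx /= [j == l :> nat]eq_sym (inj_eq (@ord_inj _)) (negbTE ne)
    ?andbF mulr0.
by rewrite addr0 mxsumZE mxE munitE !eqxx mulr1.
Qed.

Definition msubalg (S : set T) : Prop :=
  [/\ S 1, forall c x y, S x -> S y -> S (c *: x + y) &
      forall x y, S x -> S y -> S (x * y)].

Section Closure.
Variables (S : set T) (hS : msubalg S).

Lemma msub1 : S 1. Proof. by case: hS. Qed.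
Lemma msub0 : S 0.
Proof.
case: hS => h1 h _; have := h (-1) _ _ h1 h1.
by rewrite scaleN1r addNr.
Qed.
Lemma msubZ c x : S x -> S (c *: x).
Proof. by case: hS => _ h _ hx; rewrite -[_ *: _]addr0; apply: h msub0. Qed.
Lemma msubD x y : S x -> S y -> S (x + y).
Proof. by case: hS => _ h _ hx hy; rewrite -[x]scale1r; apply: h. Qed.
Lemma msubB x y : S x -> S y -> S (x - y).
Proof. by move=> hx hy; rewrite -scaleN1r addrC; case: hS => _ h _; apply: h. Qed.
Lemma msubM x y : S x -> S y -> S (x * y).
Proof. by case: hS => _ _; apply. Qed.
Lemma msub_sum (I : Type) (r : seq I) (Q : pred I) (F : I -> T) :
  (forall i, Q i -> S (F i)) -> S (\sum_(i <- r | Q i) F i).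
Proof. by move=> h; apply: big_ind => //; [exact: msub0|exact: msubD]. Qed.

Definition tridiag n (M : 'M[R]_n) : Prop :=
  forall i j : 'I_n,
    (((i.+1 < j)%N || (j.+1 < i)%N) -> M i j = 0) /\
    ((j == i.+1 :> nat) || (i == j.+1 :> nat) -> M i j != 0).

(** Multiplying e_(0k) by X on the right gives a combination of e_(0,k-1), e_(0k) and
    e_(0,k+1), the last one with a nonzero coefficient; so S climbs along the first row. *)
Lemma krylov_row (X : T) p : tridiag (X p) -> S X -> S (munit p 0 0) ->
  forall k, (k < s p)%N -> S (munit p 0 k).
Proof.
move=> tri SX S0 k.
elim: k {-2}k (leqnn k) => [[|//]|k IH] // k' lek hk.
move: lek; rewrite leq_eqVlt => /orP [/eqP e|]; last by move=> h; apply: IH.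
subst k'.
have hk0 : (k < s p)%N by apply: ltnW.
have e : X p (Ordinal hk0) (Ordinal hk) *: munit p 0 k.+1 =
  munit p 0 k * X - \sum_(l < s p | (l <= k)%N) X p (Ordinal hk0) l *: munit p 0 l.
  apply: mxsumP => p' i j; rewrite mxsumBe mxsumZe.
  case: (eqVneq p' p) => [e|ne]; last first.
    rewrite munitE (negbTE ne) mulr0.
    rewrite mxsumME [X in X - _]mxE big1 => [|t _]; last by rewrite munitE (negbTE ne) mul0r.
    rewrite mxsum_sume big1 ?subrr // => t _.
    by rewrite mxsumZe munitE (negbTE ne) mulr0.
  subst p'; rewrite munitE eqxx /= (mul_munit _ _ _ _ _ hk0) eqxx /=.
  rewrite mxsum_sume.
  under eq_bigr do rewrite mxsumZe munitE eqxx /=.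
  case: (eqVneq (i : nat) 0%N) => [i0|i0] /=; last first.
    by rewrite mulr0 mul0r big1 ?subrr // => t _; rewrite mulr0.
  rewrite mul1r; case: (leqP j k) => jk.
    rewrite (bigD1 j) //= eqxx mulr1 big1 ?addr0 ?subrr; last first.
      by move=> t /andP [_ ne]; rewrite [j == t :> nat]eq_sym (inj_eq (@ord_inj _)) (negbTE ne)
        mulr0.
    by rewrite (_ : _ == _ = false) ?mulr0 //; lia.
  rewrite big1 ?subr0; last first.
    by move=> t tk; rewrite (_ : _ == _ = false) ?mulr0 //; lia.
  case: (eqVneq (j : nat) k.+1) => [jk1|jk1].
    by rewrite mulr1; congr (X p _ _); apply: val_inj.
  rewrite mulr0; case: (tri (Ordinal hk0) j) => -> //=; lia.
have nz : X p (Ordinal hk0) (Ordinal hk) != 0.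
  by case: (tri (Ordinal hk0) (Ordinal hk)) => _; apply; rewrite /= eqxx.
rewrite -[munit _ _ _]scale1r -(mulVf nz) -scalerA e; apply: msubZ.
apply: msubB; first by apply: msubM => //; apply: IH.
by apply: msub_sum => l lk; apply/msubZ/IH.
Qed.

(** Evaluate at c the polynomial that vanishes at all the values of c but c p: products of
    combinations of the orthogonal idempotents munit p 0 0 are computed on the coefficients. *)
Lemma munit00_separate (Q : pred P) (c : P -> R) :
  {in Q, forall p, (0 < s p)%N} -> {in Q &, injective c} ->
  S (\sum_(p | Q p) munit p 0 0) -> S (\sum_(p | Q p) c p *: munit p 0 0) ->
  {in Q, forall p, S (munit p 0 0)}.
Proof.
move=> s_gt0 c_inj S1 Sc p Qp.
pose Z (f : P -> R) := \sum_(p | Q p) f p *: munit p 0 0.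
have ZM f g : Z f * Z g = Z (fun p => f p * g p).
  rewrite /Z big_distrl /=; apply: eq_bigr => p1 Q1.
  rewrite big_distrr /= (bigD1 p1) //= big1 ?addr0.
    rewrite -mxsum_scalerAl -mxsum_scalerAr munitM ?s_gt0 //.
    by rewrite !eqxx scale1r scalerA.
  move=> p2 /andP [Q2 ne]; rewrite -mxsum_scalerAl -mxsum_scalerAr munitM ?s_gt0 //.
  by rewrite eq_sym (negbTE ne) scale0r !scaler0.
have key (r : seq P) : S (Z (fun p1 => \prod_(p2 <- r) (c p1 - c p2))).
  elim: r => [|p2 r IH].
    rewrite /Z; under eq_bigr do rewrite big_nil scale1r; exact: S1.
  rewrite (_ : Z _ = Z (fun p1 => c p1 - c p2) *
     Z (fun p1 => \prod_(p2 <- r) (c p1 - c p2))).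
    apply: msubM => //; rewrite /Z.
    under eq_bigr do rewrite scalerBl.
    rewrite sumrB; apply: msubB => //.
    by rewrite -scaler_sumr; apply: msubZ.
  rewrite ZM /Z; apply: eq_bigr => p1 _; by rewrite big_cons.
have := key [seq p2 <- enum P | Q p2 & p2 != p].
rewrite /Z (bigD1 p) //= [X in _ + X]big1 ?addr0; last first.
  move=> p1 /andP [Q1 ne]; rewrite (big_rem p1) /= ?subrr ?mul0r ?scale0r //.
  by rewrite mem_filter ne Q1 mem_enum.
set a := \prod_(_ <- _) _.
have nz : a != 0.
  rewrite /a big_seq prodf_seq_neq0; apply/allP => p1 _; apply/implyP.
  rewrite mem_filter => /andP [/andP [Q1 ne] _]; rewrite subr_eq0.
  by apply: contra ne => /eqP e; apply/eqP/c_inj.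
by move=> h; rewrite -[munit _ _ _]scale1r -(mulVf nz) -scalerA; apply: msubZ.
Qed.

End Closure.

Definition mxsum_tr (x : T) : T := [ffun p => (x p)^T].

Lemma mxsum_tr_munit p k l : mxsum_tr (munit p k l) = munit p l k.
Proof. by apply: mxsumP => p' i j; rewrite ffunE mxE !munitE andbAC. Qed.

Lemma mxsum_trK : involutive mxsum_tr.
Proof. by move=> x; apply/ffunP => p; rewrite !ffunE trmxK. Qed.

Lemma mxsum_tr_sub (S : set T) : msubalg S -> msubalg [set x | S (mxsum_tr x)]%classic.
Proof.
move=> [S1 Sl SM]; split=> [|c x y hx hy|x y hx hy] /=.
- by rewrite (_ : mxsum_tr 1 = 1) //; apply/ffunP => p; rewrite !ffunE trmx1.
- rewrite (_ : mxsum_tr _ = c *: mxsum_tr x + mxsum_tr y); first exact: Sl.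
  by apply/ffunP => p; rewrite !ffunE linearD linearZ.
- rewrite (_ : mxsum_tr _ = mxsum_tr y * mxsum_tr x); first exact: SM.
  by apply/ffunP => p; rewrite !ffunE trmx_mul.
Qed.

(** The first column of the block is obtained from its first row by transposing, and e_(kl) =
    e_(k0) e_(0l). *)
Lemma tridiag_krylov (S : set T) (X : T) p : msubalg S -> tridiag (X p) ->
  S X -> S (munit p 0 0) ->
  forall k l, (k < s p)%N -> (l < s p)%N -> S (munit p k l).
Proof.
move=> hS tri SX S0 k l hk hl.
have -> : munit p k l = munit p k 0 * munit p 0 l.
  by rewrite munitM ?(leq_ltn_trans _ hk) // !eqxx scale1r.
apply: (msubM hS); last exact: (krylov_row hS tri SX S0).
rewrite -mxsum_tr_munit.
apply: (@krylov_row [set x | S (mxsum_tr x)]%classic (mxsum_tr_sub hS) (mxsum_tr X)) => //=.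
- by move=> i j; rewrite ffunE mxE; have [t1 t2] := tri j i; split=> h;
    [apply: t1|apply: t2]; rewrite orbC.
- by rewrite mxsum_trK.
- by rewrite mxsum_tr_munit.
Qed.

End MxUnits.

(** * Algebras spanned by a system of matrix units *)

Section FiniteFamily.
Variables (R : fieldType) (vT : vectType R) (J : finType) (f : J -> vT).

Lemma mem_span_family v : v \in <<codom f>>%VS ->
  exists c : J -> R, v = \sum_j c j *: f j.
Proof.
move=> hv.
pose S := [pred v | `[< exists c : J -> R, v = \sum_j c j *: f j >] ].
pose g := linfun (fun c : {ffun J -> R^o} => \sum_j c j *: f j).
have glin : linear (fun c : {ffun J -> R^o} => \sum_j c j *: f j).
  move=> a c c'; rewrite scaler_sumr -big_split; apply: eq_bigr => j _ /=.
  by rewrite !ffunE scalerDl scalerA.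
have gE c : g c = \sum_j c j *: f j.
  pose gl := GRing.isLinear.Build R {ffun J -> R^o} vT _
     (fun c : {ffun J -> R^o} => \sum_j c j *: f j) glin.
  pose h : {linear {ffun J -> R^o} -> vT} := HB.pack (fun c : {ffun J -> R^o} => \sum_j c j *: f
    j) gl.
  by rewrite /g -[LHS]/(linfun h c) lfunE.
have sub : (<<codom f>> <= limg g)%VS.
  apply/span_subvP => _ /codomP [j ->].
  have -> : f j = g [ffun j' => (j' == j)%:R].
    rewrite gE (bigD1 j) //= ffunE eqxx scale1r big1 ?addr0 // => j' ne.
    by rewrite ffunE (negbTE ne) scale0r.
  by apply: memv_img; rewrite memvf.
have /memv_imgP [c _ ->] := subvP sub _ hv.
by exists c; rewrite gE.
Qed.

Lemma sum_mem_span (c : J -> R) : \sum_j c j *: f j \in <<codom f>>%VS.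
Proof.
by apply: memv_suml => j _; apply/memvZ/memv_span/codom_f.
Qed.

Lemma free_family : (forall c : J -> R, \sum_j c j *: f j = 0 -> forall j, c j = 0) ->
  free (codom f).
Proof.
move=> h; apply/(@freeP _ _ _ [tuple of codom f]) => k.
have -> : \sum_(i < #|J|) k i *: [tuple of codom f]`_i =
   \sum_j k (enum_rank j) *: f j.
  rewrite [RHS](reindex_onto enum_val enum_rank) /=; last by move=> i _; rewrite enum_rankK.
  under [RHS]eq_bigl do rewrite enum_valK eqxx.
  apply: eq_bigr => i _; rewrite enum_valK; congr (_ *: _).
  rewrite (nth_map (enum_val i)) -?cardE //; congr f.
  by rewrite [RHS](enum_val_nth (enum_val i)).
by move=> /h e i; rewrite -(enum_valK i).
Qed.

Lemma dim_span_family : free (codom f) -> \dim <<codom f>> = #|J|.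
Proof. by rewrite /free => /eqP ->; rewrite size_codom. Qed.
End FiniteFamily.

Lemma mxsum_ind (R : fieldType) (P : finType) (s : P -> nat) (Q : mxsum R s -> Prop) :
  Q 0 -> (forall x y, Q x -> Q y -> Q (x + y)) ->
  (forall c p k l, (k < s p)%N -> (l < s p)%N -> Q (c *: munit R s p k l)) ->
  forall x, Q x.
Proof.
move=> Q0 QD QZ x; rewrite (mxsum_decomp x).
by do 3 (apply: big_ind => // ? _); apply: QZ.
Qed.

Section Emb.
Variables (R : realType) (P : finType) (s : P -> nat) (N : nat).
Variable W : P -> nat -> nat -> 'M[R]_N.
Local Notation T := (mxsum R s).

(** The relations of matrix units: then the algebra spanned by the W p k l is the direct sum of
    full matrix algebras of sizes s p, except that its unit need not be the identity matrix. *)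
Definition unit_system : Prop :=
  (forall p p' k l k' l', (k < s p)%N -> (l < s p)%N -> (k' < s p')%N -> (l' < s p')%N ->
     W p k l *m W p' k' l' = ((p == p') && (l == k'))%:R *: W p k l') /\
  (forall p k, (k < s p)%N -> W p k k != 0).

Definition emb (x : T) : 'M[R]_N :=
  \sum_p \sum_(k < s p) \sum_(l < s p) x p k l *: W p k l.

Lemma emb_linear : linear emb.
Proof.
move=> c x y; rewrite /emb scaler_sumr -big_split; apply: eq_bigr => p _ /=.
rewrite scaler_sumr -big_split; apply: eq_bigr => k _ /=.
rewrite scaler_sumr -big_split; apply: eq_bigr => l _ /=.
by rewrite mxsumDe mxsumZe scalerDl scalerA.
Qed.

Lemma emb0 : emb 0 = 0.
Proof.
have := emb_linear (-1) 0 0; rewrite scaler0 add0r => ->.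
by rewrite scaleN1r addNr.
Qed.
Lemma embD x y : emb (x + y) = emb x + emb y.
Proof. by have := emb_linear 1 x y; rewrite !scale1r. Qed.
Lemma embZ c x : emb (c *: x) = c *: emb x.
Proof. by have := emb_linear c x 0; rewrite !addr0 emb0 addr0. Qed.

Lemma emb_munit p k l : (k < s p)%N -> (l < s p)%N ->
  emb (munit R s p k l) = W p k l.
Proof.
move=> hk hl; rewrite /emb (bigD1 p) //= [X in _ + X]big1 ?addr0; last first.
  move=> p' ne; apply: big1 => k' _; apply: big1 => l' _.
  by rewrite munitE (negbTE ne) scale0r.
rewrite (bigD1 (Ordinal hk)) //= [X in _ + X]big1 ?addr0; last first.
  move=> k' ne; apply: big1 => l' _; rewrite munitE eqxx /=.
  rewrite (_ : _ == _ = false) ?scale0r //.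
  by apply/negbTE; apply: contra ne => /eqP e; apply/eqP/val_inj.
rewrite (bigD1 (Ordinal hl)) //= [X in _ + X]big1 ?addr0; last first.
  move=> k' ne; rewrite munitE !eqxx /=.
  rewrite (_ : _ == _ = false) ?scale0r //.
  by apply/negbTE; apply: contra ne => /eqP e; apply/eqP/val_inj.
by rewrite munitE !eqxx scale1r.
Qed.

Lemma emb_in_sub (S : set 'M[R]_N) : is_subalgebra S ->
  (forall p k l, (k < s p)%N -> (l < s p)%N -> S (W p k l)) ->
  forall x, S (emb x).
Proof.
move=> [S1 Sl SM] SW.
have S0 : S 0 by have := Sl (-1) _ _ S1 S1; rewrite scaleN1r addNr.
have SZ c M : S M -> S (c *: M) by move=> h; rewrite -[_ *: _]addr0; apply: Sl.
have SD M M' : S M -> S M' -> S (M + M') by move=> h; rewrite -[X in X + _]scale1r; apply: Sl.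
move=> x; rewrite /emb.
by do 3 (apply: big_ind => // ? _); apply/SZ/SW.
Qed.

Lemma emb_dim : injective emb ->
  has_dim (range emb) (\sum_p s p ^ 2)%N.
Proof.
move=> emb_inj; pose J := {p : P & ('I_(s p) * 'I_(s p))%type}.
pose f (u : J) := W (tag u) (tagged u).1 (tagged u).2.
have embE x : emb x = \sum_(u : J) x (tag u) (tagged u).1 (tagged u).2 *: f u.
  transitivity (\sum_p \sum_(u : 'I_(s p) * 'I_(s p)) x p u.1 u.2 *: W p u.1 u.2).
    by apply: eq_bigr => p _; rewrite pair_big.
  exact: (sig_big_dep _ (fun _ => predT)
     (fun p (u : 'I_(s p) * 'I_(s p)) => x p u.1 u.2 *: W p u.1 u.2)).
have toJ (c : J -> R) : exists x : T, \sum_u c u *: f u = emb x /\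
    forall u, c u = x (tag u) (tagged u).1 (tagged u).2.
  pose x : T := [ffun p => \matrix_(k, l) c (Tagged (fun p => ('I_(s p) * 'I_(s p))%type) (k, l))].
  have xE u : c u = x (tag u) (tagged u).1 (tagged u).2.
    by case: u => p [k l]; rewrite /x ffunE mxE.
  exists x; split => //; rewrite embE; apply: eq_bigr => u _; by rewrite -xE.
exists <<codom f>>%VS.
  apply/seteqP; split => [_ [x _ <-]|M /= hM].
    by rewrite /= embE; apply: (sum_mem_span f (fun u => x (tag u) (tagged u).1 (tagged u).2)).
  have [c ->] := mem_span_family hM.
  by have [x [-> _]] := toJ c; exists x.
rewrite dim_span_family.
  rewrite card_tagged sumnE big_map big_enum /=; apply: eq_bigr => p _.
  by rewrite card_prod card_ord.
apply: free_family => c; have [x [-> e]] := toJ c; rewrite -emb0 => /emb_inj x0 u.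
by rewrite e x0 mxsum0E mxE.
Qed.

Hypothesis us : unit_system.

Lemma embM x y : emb (x * y) = emb x *m emb y.
Proof.
elim/(@mxsum_ind R P s): x => [|x x' hx hx'|c p k l hk hl].
- by rewrite mul0r emb0 mul0mx.
- by rewrite mulrDl !embD hx hx' mulmxDl.
rewrite -mxsum_scalerAl !embZ -scalemxAl; congr (_ *: _).
elim/(@mxsum_ind R P s): y => [|y y' hy hy'|c' p' k' l' hk' hl'].
- by rewrite mulr0 emb0 mulmx0.
- by rewrite mulrDr !embD hy hy' mulmxDr.
rewrite -mxsum_scalerAr !embZ -scalemxAr; congr (_ *: _).
rewrite munitM // embZ [emb (munit _ _ _ k l)]emb_munit // [emb (munit _ _ _ k' l')]emb_munit //.
rewrite us.1 //; case: (eqVneq p p') => [e|_] /=; last by rewrite !scale0r.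
by subst p'; rewrite emb_munit.
Qed.

(** The entries of x are recovered from its image by multiplying by units on both sides. *)
Lemma emb_inj : injective emb.
Proof.
have ker x : emb x = 0 -> x = 0.
  move=> h; apply: mxsumP => p i j; rewrite mxsum0E mxE.
  have : emb (munit R s p i i * x * munit R s p j i) = 0.
    by rewrite !embM h mulmx0 mul0mx.
  have -> : munit R s p i i * x * munit R s p j i = x p i j *: munit R s p i i.
    apply: mxsumP => p' i' j'; rewrite mxsumZe munitE.
    case: (eqVneq p' p) => [e|ne]; last first.
      rewrite mulr0 mxsumME mxE big1 // => t _; rewrite munitE (negbTE ne) mulr0 //.
    subst p'; rewrite (mulx_munit _ _ _ _ _ (ltn_ord j)) (mul_munit _ _ _ _ _ (ltn_ord i)) eqxx /=.
    have -> : Ordinal (ltn_ord i) = i by apply: val_inj.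
    have -> : Ordinal (ltn_ord j) = j by apply: val_inj.
    by case: (_ == i :> nat); case: (_ == i :> nat); rewrite /= ?mul1r ?mul0r ?mulr0 ?mulr1.
  rewrite embZ emb_munit //; move/eqP; rewrite scaler_eq0 (negbTE (us.2 p i (ltn_ord i))) orbF.
  by move/eqP.
move=> x y e; apply/eqP; rewrite -subr_eq0; apply/eqP/ker.
by rewrite embD -scaleN1r embZ e scaleN1r subrr.
Qed.

Lemma emb_range (S : set 'M[R]_N) : is_subalgebra S ->
  (forall p k l, (k < s p)%N -> (l < s p)%N -> S (W p k l)) ->
  (forall M, S M -> exists x, M = emb x) -> range emb = S.
Proof.
move=> Ssub SW hS; apply/seteqP; split => [_ [x _ <-]|M /hS [x ->]]; last by exists x.
exact: emb_in_sub.
Qed.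

(** The image of 1 is a unit of the range, so it is the identity as soon as the range contains
    the identity. *)
Lemma emb_unit : range emb 1%:M -> emb 1 = 1%:M.
Proof. by move=> [u _ eu]; rewrite -[LHS]mulmx1 -eu -embM mul1r. Qed.

Lemma range_subalg : range emb 1%:M -> is_subalgebra (range emb).
Proof.
move=> h1; split => //.
- by move=> c _ _ [x _ <-] [y _ <-]; exists (c *: x + y); rewrite // emb_linear.
- by move=> _ _ [x _ <-] [y _ <-]; exists (x * y); rewrite // embM.
Qed.

End Emb.

Lemma gen_alg_sub (R : realType) n (X : set 'M[R]_n) (S : set 'M[R]_n) :
  is_subalgebra S -> (forall M, X M -> S M) -> forall M, gen_alg X M -> S M.
Proof. by move=> h1 h2 M; apply. Qed.

Lemma gen_algP (R : realType) n (X : set 'M[R]_n) : is_subalgebra (gen_alg X).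
Proof.
split.
- by move=> S [[]].
- by move=> c M M' h h' S hS; have [[_ hl _] _] := hS; apply: hl; [apply: h|apply: h'].
- by move=> M M' h h' S hS; have [[_ _ hm] _] := hS; apply: hm; [apply: h|apply: h'].
Qed.

Lemma gen_alg_incl (R : realType) n (X : set 'M[R]_n) M : X M -> gen_alg X M.
Proof. by move=> h S [_]; apply. Qed.

(** * One module of each type *)

Lemma sum_pick (R : fieldType) n (g : nat -> R) k :
  \sum_(l < n) (l == k :> nat)%:R * g l = if (k < n)%N then g k else 0.
Proof.
case: ltnP => h.
  rewrite (bigD1 (Ordinal h)) //= eqxx mul1r big1 ?addr0 // => l ne.
  rewrite (_ : (_ == _) = false) ?mul0r //; apply/negbTE.
  by apply: contra ne => /eqP e; apply/eqP/val_inj.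
by rewrite big1 // => l _; rewrite (_ : (_ == _) = false) ?mul0r //; have := ltn_ord l; lia.
Qed.

Section HammingAction.
Variables (R : realType) (d q : nat).
Local Notation V := {ffun 'I_d -> 'I_q}.

Definition update_at (x : V) (i : 'I_d) (b : 'I_q) : V := [ffun j => if j == i then b else x j].

Lemma hamming_sum (x : V) (f : V -> R) :
  \sum_y (hamming d q x y)%:R * f y = \sum_i \sum_(b | b != x i) f (update_at x i b).
Proof.
pose cond i (y : V) := (y i != x i) && [forall j, (j != i) ==> (x j == y j)].
have -> : \sum_i \sum_(b | b != x i) f (update_at x i b) = \sum_i \sum_(y | cond i y) f y.
  apply: eq_bigr => i _; rewrite [RHS](reindex_onto (update_at x i) (fun y => y i)) /=; last first.
    move=> y /andP [_ /forallP h]; apply/ffunP => j; rewrite ffunE.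
    by case: eqP => [-> //|/eqP ne]; have /implyP /(_ ne) /eqP := h j.
  apply: eq_bigl => b; rewrite /cond !ffunE !eqxx andbT.
  case: eqP => //= _; symmetry; apply/forallP => j; apply/implyP => ne.
  by rewrite ffunE (negbTE ne).
rewrite (exchange_big_dep predT) //=; apply: eq_bigr => y _.
rewrite /hamming /cart_power; case: existsP => [[i /andP [h1 h2]]|h].
  rewrite mul1r (big_pred1 i) // => i'; apply/idP/eqP => [/andP [h3 _]|->]; last first.
    by rewrite /cond eq_sym h1.
  apply/eqP; apply/negPn/negP => ne.
  by have /forallP /(_ i') := h2; rewrite ne /= eq_sym (negbTE h3).
rewrite mul0r big1 // => i h'; case: h; exists i; move: h' => /andP [h1 h2].
by rewrite eq_sym h1.
Qed.

Lemma prod_change (I : finType) (F G : I -> R) t : (forall u, u != t -> F u = G u) ->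
  \prod_u F u = F t * \prod_(u | u != t) G u.
Proof. by move=> h; rewrite (bigD1 t) //=; congr (_ * _); apply: eq_bigr. Qed.

Lemma sum_neq (u : 'I_q) (g : 'I_q -> R) :
  \sum_(b | b != u) g b = \sum_b g b - g u.
Proof. by rewrite [in RHS](bigD1 u) //= addrAC subrr add0r. Qed.

Lemma sum_eq (u : 'I_q) : \sum_b (b == u)%:R = 1 :> R.
Proof.
rewrite (bigD1 u) //= eqxx big1 ?addr0 // => b /negbTE -> //.
Qed.

Lemma sum_const (c : R) : \sum_(b : 'I_q) c = c * q%:R.
Proof. by rewrite sumr_const card_ord mulr_natr. Qed.

Variable a : V.

Definition weight (x : V) : nat := \sum_i (x i != a i).

Section ModuleVectors.
Variables (b c : V) (r j m : nat).
Local Notation K := (('I_r + 'I_j) + ('I_j + 'I_m))%type.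
Variables (phi : K -> 'I_d) (psi : 'I_d -> K).
Hypotheses (phiK : cancel phi psi) (psiK : cancel psi phi).
Hypothesis (hb : forall i, b i != a i).
Hypothesis (hc : (0 < r)%N -> forall i, (c i != a i) && (c i != b i)).

Let p1 t := phi (inl (inl t)).
Let p2 t := phi (inl (inr t)).
Let p3 t := phi (inr (inl t)).
Let p4 t := phi (inr (inr t)).
Let omega (i : 'I_d) (u : 'I_q) : R := (u == b i)%:R - (u == c i)%:R.
Let alpha (i : 'I_d) (u : 'I_q) : R := (u == a i)%:R.

Definition omega_part (x : V) : R := \prod_t omega (p1 t) (x (p1 t)).
Definition det_part (x : V) : R := \prod_t (alpha (p2 t) (x (p2 t)) - alpha (p3 t) (x (p3 t))).
Definition free_weight (x : V) : nat := \sum_t (x (p4 t) != a (p4 t)).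
(** The vectors v_k of the module of type (r, j). The bijection phi splits the d positions into
    r positions carrying delta_b - delta_c, which sums to zero off the root; j pairs carrying
    delta_a (x) u - u (x) delta_a, whose value at a pair of letters is [first letter is a] -
    [second letter is a]; and m free positions, of which k differ from the root. *)
Definition module_vec (k : nat) (x : V) : R := omega_part x * det_part x * (free_weight x == k)%:R.

Lemma update_at_phi (x : V) k u k' : update_at x (phi k) u (phi k') = if k' == k then u else x
  (phi k').
Proof. by rewrite ffunE (can_eq phiK). Qed.

Lemma phi_sum (F : 'I_d -> R) : \sum_i F i =
  (\sum_t F (p1 t) + \sum_t F (p2 t)) + (\sum_t F (p3 t) + \sum_t F (p4 t)).
Proof.
rewrite (reindex phi) /=; last by exists psi => ? _; [apply: phiK|apply: psiK].
by rewrite !big_sumType.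
Qed.

Lemma phi_sumn (F : 'I_d -> nat) : (\sum_i F i =
  (\sum_t F (p1 t) + \sum_t F (p2 t)) + (\sum_t F (p3 t) + \sum_t F (p4 t)))%N.
Proof.
rewrite (reindex phi) /=; last by exists psi => ? _; [apply: phiK|apply: psiK].
by rewrite !big_sumType.
Qed.

(** A zero-sum vector is an eigenvector of A(K_q) for the eigenvalue -1. *)
Lemma update_sum_omega k (x : V) t : \sum_(u | u != x (p1 t)) module_vec k (update_at x (p1 t) u)
  = - module_vec k x.
Proof.
pose C := \prod_(t' | t' != t) omega (p1 t') (x (p1 t')).
have e u : module_vec k (update_at x (p1 t) u) = omega (p1 t) u * (C * det_part x * (free_weight
  x == k)%:R).
  rewrite /module_vec (_ : omega_part _ = omega (p1 t) u * C).
    have -> : det_part (update_at x (p1 t) u) = det_part x.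
      by apply: eq_bigr => t' _; rewrite !update_at_phi.
    have -> : free_weight (update_at x (p1 t) u) = free_weight x.
      by apply: eq_bigr => t' _; rewrite !update_at_phi.
    by rewrite !mulrA.
  rewrite /omega_part (@prod_change _ _ (fun t' => omega (p1 t') (x (p1 t'))) t) ?update_at_phi
    ?eqxx //.
  by move=> t' ne; rewrite update_at_phi (_ : _ == _ = false) //; apply/negbTE; apply: contra ne
    => /eqP [->].
under eq_bigr do rewrite e.
rewrite -big_distrl /= sum_neq sumrB !sum_eq subrr sub0r mulNr; congr (- _).
rewrite /module_vec /omega_part (@prod_change _ _ (fun t' => omega (p1 t') (x (p1 t'))) t) //.
by rewrite !mulrA.
Qed.

(** On an antisymmetrised pair A acts as the trace q - 2 of A(K_q) on the plane spanned by
    delta_a and u. *)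
Lemma update_sum_det k (x : V) t : \sum_(u | u != x (p2 t)) module_vec k (update_at x (p2 t) u) +
  \sum_(u | u != x (p3 t)) module_vec k (update_at x (p3 t) u) = (q%:R - 2) * module_vec k x.
Proof.
pose C := \prod_(t' | t' != t) (alpha (p2 t') (x (p2 t')) - alpha (p3 t') (x (p3 t'))).
have e2 u : module_vec k (update_at x (p2 t) u) =
    (alpha (p2 t) u - alpha (p3 t) (x (p3 t))) * (omega_part x * C * (free_weight x == k)%:R).
  rewrite /module_vec (_ : det_part _ = (alpha (p2 t) u - alpha (p3 t) (x (p3 t))) * C).
    have -> : omega_part (update_at x (p2 t) u) = omega_part x.
      by apply: eq_bigr => t' _; rewrite !update_at_phi.
    have -> : free_weight (update_at x (p2 t) u) = free_weight x.
      by apply: eq_bigr => t' _; rewrite !update_at_phi.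
    by ring.
  rewrite /det_part (@prod_change _ _
    (fun t' => alpha (p2 t') (x (p2 t')) - alpha (p3 t') (x (p3 t'))) t) ?update_at_phi ?eqxx //.
  by move=> t' ne; rewrite !update_at_phi (_ : (inl (inr t') == _) = false) //; apply/negbTE;
    apply: contra ne => /eqP [->].
have e3 u : module_vec k (update_at x (p3 t) u) =
    (alpha (p2 t) (x (p2 t)) - alpha (p3 t) u) * (omega_part x * C * (free_weight x == k)%:R).
  rewrite /module_vec (_ : det_part _ = (alpha (p2 t) (x (p2 t)) - alpha (p3 t) u) * C).
    have -> : omega_part (update_at x (p3 t) u) = omega_part x.
      by apply: eq_bigr => t' _; rewrite !update_at_phi.
    have -> : free_weight (update_at x (p3 t) u) = free_weight x.
      by apply: eq_bigr => t' _; rewrite !update_at_phi.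
    by ring.
  rewrite /det_part (@prod_change _ _
    (fun t' => alpha (p2 t') (x (p2 t')) - alpha (p3 t') (x (p3 t'))) t) ?update_at_phi ?eqxx //.
  by move=> t' ne; rewrite !update_at_phi (_ : (inr (inl t') == inr _) = false) //;
     apply/negbTE; apply: contra ne => /eqP [->].
under eq_bigr do rewrite e2.
under [X in _ + X]eq_bigr do rewrite e3.
rewrite -!big_distrl /= !sum_neq !sumrB !sum_eq !sum_const.
rewrite /module_vec /det_part (@prod_change _ _
  (fun t' => alpha (p2 t') (x (p2 t')) - alpha (p3 t') (x (p3 t'))) t) // -/C.
by ring.
Qed.

(** On a free position A(K_q) sends delta_a to u and u to (q - 1) delta_a + (q - 2) u. *)
Lemma update_sum_free k (x : V) t : \sum_(u | u != x (p4 t)) module_vec k (update_at x (p4 t) u) =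
  omega_part x * det_part x *
  ((x (p4 t) != a (p4 t))%:R * ((free_weight x == k.+1)%:R + (q%:R - 2) * (free_weight x == k)%:R)
   + (1 - (x (p4 t) != a (p4 t))%:R) * (q%:R - 1) * ((free_weight x).+1 == k)%:R).
Proof.
pose S := (\sum_(t' | t' != t) (x (p4 t') != a (p4 t')))%N.
have e u : module_vec k (update_at x (p4 t) u) =
    omega_part x * det_part x * ((u != a (p4 t)) + S == k)%N%:R.
  rewrite /module_vec; have -> : omega_part (update_at x (p4 t) u) = omega_part x.
    by apply: eq_bigr => t' _; rewrite !update_at_phi.
  have -> : det_part (update_at x (p4 t) u) = det_part x.
    by apply: eq_bigr => t' _; rewrite !update_at_phi.
  congr (_ * (_ == _)%:R); rewrite /free_weight (bigD1 t) //= update_at_phi eqxx; congr (_ + _)%N.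
  apply: eq_bigr => t' ne; rewrite update_at_phi (_ : (inr (inr t') == _) = false) //.
  by apply/negbTE; apply: contra ne => /eqP [->].
under eq_bigr do rewrite e.
rewrite -big_distrr /=; congr (_ * _).
have -> : free_weight x = ((x (p4 t) != a (p4 t)) + S)%N by rewrite /free_weight (bigD1 t).
have e' u : ((u != a (p4 t)) + S == k)%N%:R =
    (u == a (p4 t))%:R * ((S == k)%:R - (S.+1 == k)%:R) + (S.+1 == k)%:R :> R.
  by case: (u == _) => /=; ring.
rewrite sum_neq; under eq_bigr do rewrite e'.
rewrite big_split /= -big_distrl /= sum_eq sum_const.
case: (x (p4 t) == a (p4 t)) => /=; rewrite ?add0n ?add1n ?eqSS; ring.
Qed.

Lemma free_weight_le x : (free_weight x <= m)%N.
Proof.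
rewrite /free_weight; apply: (@leq_trans (\sum_(t < m) 1)%N).
  by apply: leq_sum => t _; case: (_ != _).
by rewrite sum1_card card_ord.
Qed.

(** Summing the local contributions of the r, j + j and m positions. At k = 0 there is no lower
    neighbour, whence the factor (0 < k), the predecessor of 0 being 0. *)
Lemma adj_module_vec k x : \sum_y (hamming d q x y)%:R * module_vec k y =
  (k.+1)%:R * module_vec k.+1 x + ((q%:R - 2) * (k%:R + j%:R) - r%:R) * module_vec k x +
  (0 < k)%:R * ((q%:R - 1) * (m%:R - k%:R + 1) * module_vec k.-1 x).
Proof.
rewrite hamming_sum phi_sum.
under eq_bigr do rewrite update_sum_omega.
under [X in _ + (_ + X)]eq_bigr do rewrite update_sum_free.
rewrite [X in X + _]addrC -addrA [X in _ + X]addrCA !addrA -big_split /=.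
under eq_bigr do rewrite update_sum_det.
rewrite !sumr_const !card_ord -big_distrr /= big_split /= -big_distrl /=.
have swE : \sum_(i < m) (x (p4 i) != a (p4 i))%:R = (free_weight x)%:R :> R.
  by rewrite /free_weight natr_sum.
rewrite swE.
under eq_bigr do rewrite -mulrA.
rewrite -big_distrl /= sumrB swE sumr_const card_ord.
rewrite /module_vec -[_ *+ r]mulr_natl -[_ *+ j]mulr_natl.
have h (n : nat) : (free_weight x)%:R * (free_weight x == n)%:R = n%:R * (free_weight x == n)%:R
  :> R.
  by case: eqP => [->|]; rewrite ?mulr0.
have h1 : (free_weight x)%:R * (free_weight x == k.+1)%:R = k.+1%:R * (free_weight x == k.+1)%:R
  := h _.
have h2 : (free_weight x)%:R * (free_weight x == k)%:R = k%:R * (free_weight x == k)%:R := h _.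
have h3 : (m%:R - (free_weight x)%:R) * ((free_weight x).+1 == k)%:R =
   (0 < k)%:R * ((m%:R - k%:R + 1) * (free_weight x == k.-1)%:R) :> R.
  case: (k) => [|k']; first by rewrite mulr0 mul0r.
  rewrite eqSS /= mul1r; case: eqP => [->|]; last by rewrite !mulr0.
  by rewrite -addn1 natrD; ring.
transitivity (omega_part x * det_part x * ((free_weight x)%:R * (free_weight x == k.+1)%:R) +
  omega_part x * det_part x * (q%:R - 2) * ((free_weight x)%:R * (free_weight x == k)%:R)
  + (j%:R * (q%:R - 2) - r%:R) * (omega_part x * det_part x * (free_weight x == k)%:R)
  + omega_part x * det_part x * (q%:R - 1) * ((m%:R - (free_weight x)%:R) * ((free_weight x).+1
    == k)%:R)).
  by ring.
by rewrite h1 h2 h3; ring.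
Qed.

Lemma module_vec_weight k x : module_vec k x != 0 -> weight x = (r + j + k)%N.
Proof.
rewrite /module_vec !mulf_eq0 !negb_or => /andP [/andP [h1 h2] h3].
have {}h3 : free_weight x = k by apply/eqP; apply: contraNT h3 => /negbTE ->.
rewrite /weight phi_sumn -h3 addnA -[X in (X + _)%N]addnA; congr (_ + _ + _)%N; last first.
  rewrite -big_split /= -[RHS]card_ord -sum1_card.
  apply: eq_bigr => t _; move/prodf_neq0: h2 => /(_ t isT); rewrite /alpha.
  by case: (x (p2 t) == _); case: (x (p3 t) == _); rewrite //= subrr eqxx.
rewrite -[RHS]card_ord -sum1_card.
apply: eq_bigr => t _; move/prodf_neq0: h1 => /(_ t isT); rewrite /omega.
have r0 : (0 < r)%N by apply: leq_ltn_trans (ltn_ord t).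
have /andP [ca cb] := hc r0 (p1 t).
case: (eqVneq (x (p1 t)) (a (p1 t))) => // ->.
by rewrite ![a _ == _]eq_sym (negbTE (hb _)) (negbTE ca) subrr eqxx.
Qed.

(** A vertex at which v_k is 1 and the other v_l vanish; these vertices give an inverse on the
    right of the matrix with rows v_k. *)
Definition witness (k : nat) : V := [ffun i => match psi i with
  | inl (inl _) => b i | inl (inr _) => a i | inr (inl _) => b i
  | inr (inr t) => if (t < k)%N then b i else a i end].

Lemma module_vec_witness k l : (k <= m)%N -> module_vec l (witness k) = (l == k)%:R.
Proof.
move=> km; rewrite /module_vec /omega_part /det_part /free_weight big1 ?mul1r; last first.
  move=> t _; rewrite /omega /witness ffunE phiK eqxx.
  have r0 : (0 < r)%N by apply: leq_ltn_trans (ltn_ord t).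
  by have /andP [ca cb] := hc r0 (p1 t); rewrite eq_sym (negbTE cb) subr0.
rewrite big1 ?mul1r; last first.
  by move=> t _; rewrite /alpha /witness !ffunE !phiK eqxx (negbTE (hb _)) subr0.
congr (_ %:R); rewrite eq_sym (_ : (\sum_t _)%N = k) //.
under eq_bigr do rewrite ffunE phiK.
transitivity (\sum_(t < m) (t < k))%N.
  by apply: eq_bigr => t _; case: (t < k)%N; rewrite ?hb // eqxx.
rewrite -(big_mkord xpredT (fun t => nat_of_bool (t < k)%N)) (big_cat_nat (n := k)) //=.
rewrite [X in (_ + X)%N]big_nat_cond [X in (_ + X)%N]big1 => [|t]; last first.
  by rewrite andbT => /andP [kt _]; rewrite ltnNge kt.
rewrite addn0 (eq_big_nat _ _ (F2 := fun => 1%N)) => [|t /andP [_ ->] //].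
by rewrite sum_nat_const_nat subn0 muln1.
Qed.

End ModuleVectors.
End HammingAction.

(** * Distances and isometries of the Hamming graph *)

Section Distance.
Variables (d q : nat).
Local Notation V := {ffun 'I_d -> 'I_q}.

Definition hdist (x y : V) : nat := \sum_i (x i != y i).

Lemma hdist_sym x y : hdist x y = hdist y x.
Proof. by apply: eq_bigr => i _; rewrite eq_sym. Qed.

Lemma hdist_eq0 x y : (hdist x y == 0%N) = (x == y).
Proof.
rewrite /hdist sum_nat_eq0; apply/forallP/eqP => [h|-> i]; last by rewrite eqxx.
by apply/ffunP => i; have := h i; rewrite /= eqb0 negbK => /eqP.
Qed.

Lemma hdist_triangle x y z : (hdist x z <= hdist x y + hdist y z)%N.
Proof.
rewrite /hdist -big_split /=; apply: leq_sum => i _.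
case: (eqVneq (x i) (y i)) => [->|] //=.
by move=> _; case: (_ != _).
Qed.

Lemma hdist_le x y : (hdist x y <= d)%N.
Proof.
rewrite -[X in (_ <= X)%N]card_ord -sum1_card; apply: leq_sum => i _.
by case: (_ != _).
Qed.

Lemma hammingE x y : hamming d q x y = (hdist x y == 1%N).
Proof.
apply/existsP/idP => [[i /andP [h1 /forallP h2]]|].
  apply/sum_nat_eq1; exists i; split => //; first by rewrite h1.
  by move=> j ne _; have := h2 j; rewrite ne /= => ->.
move=> /sum_nat_eq1 [i [_ h1 h2]]; exists i; apply/andP; split.
  by move: h1; case: (_ != _).
apply/forallP => j; apply/implyP => ne; have := h2 j ne isT.
by case: eqP.
Qed.

Lemma hdist_path_le x p : path (hamming d q) x p -> (hdist x (last x p) <= size p)%N.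
Proof.
elim: p x => [|y p IH] x /=; first by move=> _; rewrite leqn0 hdist_eq0.
move=> /andP [h /IH h']; apply: leq_trans (hdist_triangle _ y _) _.
by move: h; rewrite hammingE => /eqP ->; rewrite add1n ltnS.
Qed.

Lemma hdist_path x y : exists p : (hdist x y).-tuple V, path (hamming d q) x p && (last x p == y).
Proof.
move e : (hdist x y) => n; elim: n x e => [|n IH] x e.
  by exists [tuple] => /=; move/eqP: e; rewrite hdist_eq0.
have [i hi] : exists i, x i != y i.
  apply/existsP; rewrite -negb_forall; apply/negP => /forallP h.
  by move: e; rewrite /hdist big1 // => i _; rewrite h.
pose x' := update_at x i (y i).
have e1 : hdist x x' = 1%N.
  rewrite /hdist (bigD1 i) //= big1 => [|j ne]; rewrite ffunE ?eqxx ?hi //.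
  by rewrite (negbTE ne) eqxx.
have e2 : hdist x' y = n.
  move: e; rewrite /hdist (bigD1 i) //= hi add1n => -[<-].
  rewrite (bigD1 i) //= ffunE !eqxx add0n; apply: eq_bigr => j ne.
  by rewrite ffunE (negbTE ne).
have [p /andP [h1 h2]] := IH x' e2.
exists [tuple of x' :: p]; rewrite /= h1 h2 andbT.
by rewrite hammingE e1.
Qed.

(** The bound 1 < q is used to see that the diameter d is below the number q ^ d of vertices,
    up to which the lengths of walks are searched. *)
Lemma gdist_hamming x y : (1 < q)%N -> gdist (hamming d q) x y = hdist x y.
Proof.
move=> q1; rewrite /gdist; set Pd := fun k : nat => _.
have lt : (hdist x y < #|{: V}|)%N.
  rewrite card_ffun !card_ord; apply: leq_ltn_trans (hdist_le x y) _.
  exact: ltn_expl.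
rewrite -(subnKC lt) iotaD find_cat -[(hdist x y).+1]addn1 iotaD find_cat has_cat.
have -> : has Pd (iota 0 (hdist x y)) = false.
  apply/negbTE/hasPn => k; rewrite mem_iota add0n => /andP [_ hk].
  apply/negP => /existsP [p /andP [h1 /eqP h2]].
  by have := hdist_path_le h1; rewrite h2 size_tuple leqNgt hk.
(* A shortest walk exists and no walk is shorter, so the search stops at hdist x y. *)
have hP : Pd (hdist x y) by apply/existsP; apply: hdist_path.
by rewrite /= add0n hP /= size_iota addn0.
Qed.

End Distance.

Lemma perm_extend (T : finType) (s s' : seq T) : size s = size s' -> uniq s -> uniq s' ->
  exists u : {perm T}, map u s = s'.
Proof.
elim: s s' => [|x s IH] [|x' s'] //=; first by move=> _ _ _; exists 1%g.
move=> [e] /andP [xs us] /andP [xs' us'].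
have [u hu] := IH s' e us us'.
exists (u * tperm (u x) x')%g; rewrite permM tpermL; congr (_ :: _).
rewrite -[RHS]hu; apply/eq_in_map => y ys; rewrite permM tpermD //.
  by rewrite (inj_eq perm_inj); apply: contra xs => /eqP ->.
by apply: contra xs' => /eqP ->; rewrite -hu map_f.
Qed.

(** The equality pattern of a triple; with u the letter of the root, it classifies the pairs of
    letters (v, w) up to the permutations fixing u. *)
Definition pattern3 (T : eqType) (u v w : T) : nat :=
  if v == u then (if w == u then 0 else 1) else
  if w == u then 2 else if v == w then 3 else 4.

Lemma pattern3_perm (T : finType) (u v w u' v' w' : T) :
  pattern3 u v w = pattern3 u' v' w' ->
  exists s : {perm T}, [/\ s u = u', s v = v' & s w = w'].
Proof.
have ext (s s' : seq T) : size s = size s' -> uniq s -> uniq s' ->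
    exists t : {perm T}, map t s = s' := @perm_extend T s s'.
rewrite /pattern3.
case: (eqVneq v u) => [->|vu]; case: (eqVneq v' u') => [->|vu'].
- case: (eqVneq w u) => [->|wu]; case: (eqVneq w' u') => [->|wu'] // _.
    by have [//|//|//|s /= [h]] := ext [:: u] [:: u']; exists s.
  have [//|||s /= [h1 h2]] := ext [:: u; w] [:: u'; w']; last by exists s.
    by rewrite /= inE eq_sym wu.
  by rewrite /= inE eq_sym wu'.
- by case: (w == u); case: (w' == u'); case: (v' == w').
- by case: (w == u); case: (w' == u'); case: (v == w).
- case: (eqVneq w u) => [->|wu]; case: (eqVneq w' u') => [->|wu'].
  + move=> _; have [//|||s /= [h1 h2]] := ext [:: u; v] [:: u'; v']; last by exists s.
      by rewrite /= inE eq_sym vu.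
    by rewrite /= inE eq_sym vu'.
  + by case: (v' == w').
  + by case: (v == w).
  case: (eqVneq v w) => [<-|vw]; case: (eqVneq v' w') => [<-|vw'] // _.
    have [//|||s /= [h1 h2]] := ext [:: u; v] [:: u'; v']; last by exists s.
      by rewrite /= inE eq_sym vu.
    by rewrite /= inE eq_sym vu'.
  have [//|||s /= [h1 h2 h3]] := ext [:: u; v; w] [:: u'; v'; w']; last by exists s.
    by rewrite /= !inE negb_or ![u == _]eq_sym vu wu vw.
  by rewrite /= !inE negb_or ![u' == _]eq_sym vu' wu' vw'.
Qed.

Section OrbitSpan.
Variables (R : realType) (d q n : nat).
Local Notation V := {ffun 'I_d -> 'I_q}.
Local Notation N := #|{: V}|.
Variable a : V.
(* The pattern of three distinct letters has the largest value and needs q >= 3, so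
   n = 3 is enough for q = 2 and n = 4 in general. *)
Hypothesis pat_le : forall u v w : 'I_q, (pattern3 u v w <= n)%N.

Definition isometry (g : V -> V) : Prop :=
  [/\ injective g, g a = a & forall x y, hdist (g x) (g y) = hdist x y].

(** Commutation with the permutation matrices of the isometries fixing a, written on the
    entries. *)
Definition invariant (M : 'M[R]_N) : Prop := forall g, isometry g ->
  forall x y, M (enum_rank (g x)) (enum_rank (g y)) = M (enum_rank x) (enum_rank y).

Lemma sum_enum_rank (F : 'I_N -> R) : \sum_i F i = \sum_(x : V) F (enum_rank x).
Proof.
by rewrite (reindex enum_rank) //; exists enum_val => ? _; rewrite (enum_rankK, enum_valK).
Qed.

Lemma invariant_sub : is_subalgebra [set M | invariant M].
Proof.
split => /=.
- move=> g [gi _ _] x y; rewrite !mxE (inj_eq enum_rank_inj) (inj_eq gi).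
  by rewrite (inj_eq enum_rank_inj).
- by move=> c M M' hM hM' g hg x y; rewrite !mxE hM ?hM'.
- move=> M M' hM hM' g hg x y; rewrite !mxE !sum_enum_rank.
  have [gi _ _] := hg; rewrite (reindex_inj gi) /=; apply: eq_bigr => z _.
  by rewrite hM ?hM'.
Qed.

Lemma invariant_adj : invariant (adjmx R (hamming d q)).
Proof. by move=> g [_ _ hg] x y; rewrite !mxE !enum_rankK !hammingE hg. Qed.

Lemma invariant_diag (P : nat -> bool) : invariant (diagmx R (fun x : V => P (hdist a x))).
Proof.
move=> g [gi ga hg] x y; rewrite !mxE !enum_rankK !(inj_eq enum_rank_inj) (inj_eq gi).
by rewrite -{1}ga hg.
Qed.

Definition pattern_at (x y : V) (i : 'I_d) : 'I_n.+1 := inord (pattern3 (a i) (x i) (y i)).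
(** For a pair of vertices, how many positions have each pattern. By [pattern_count_isometry]
    this determines the orbit of the pair. *)
Definition pattern_count (x y : V) : n.+1.-tuple 'I_d.+1 :=
  [tuple inord #|[pred i | pattern_at x y i == t]| | t < n.+1].

Lemma pattern_count_sum x y : (\sum_(t <- pattern_count x y) t)%N = d.
Proof.
rewrite big_map big_enum /=.
transitivity (\sum_(t < n.+1) \sum_(i < d | pattern_at x y i == t) 1)%N.
  apply: eq_bigr => t _; rewrite inordK ?sum1_card // ltnS.
  by apply: leq_trans (max_card _) _; rewrite card_ord.
by rewrite -[RHS]card_ord -sum1_card [RHS](partition_big (pattern_at x y) predT).
Qed.

(** Permute the positions so that the patterns agree, then at each position apply a permutation
    of the letters fixing the letter of the root. *)
Lemma pattern_count_isometry x y x' y' : pattern_count x y = pattern_count x' y' ->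
  exists g, [/\ isometry g, g x = x' & g y = y'].
Proof.
move=> e.
have ecard t : #|[pred i | pattern_at x y i == t]| = #|[pred i | pattern_at x' y' i == t]|.
  have b z w : (#|[pred i | pattern_at z w i == t]| < d.+1)%N.
    by rewrite ltnS; apply: leq_trans (max_card _) _; rewrite card_ord.
  have := congr1 (fun u => nat_of_ord (tnth u t)) e.
  by rewrite !tnth_mktuple !inordK.
have /tuple_permP [p hp] : perm_eq [tuple pattern_at x' y' i | i < d] [tuple pattern_at x y i | i
  < d].
  have cE z w t : count_mem t [tuple pattern_at z w i | i < d] = #|[pred i | pattern_at z w i ==
    t]|.
    by rewrite count_map -sum1_count big_enum_cond sum1_card; apply: eq_card => i; rewrite !inE.
  by apply/allP => t _; rewrite /= !cE ecard.
have locp i : pattern_at x' y' i = pattern_at x y (p i).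
  by have := congr1 (fun t : d.-tuple 'I_n.+1 => tnth t i) (val_inj hp); rewrite !tnth_mktuple.
have /fin_all_exists [u hu] i : exists u : {perm 'I_q},
    [/\ u (a (p i)) = a i, u (x (p i)) = x' i & u (y (p i)) = y' i].
  apply: pattern3_perm; have := congr1 val (locp i).
  by rewrite /pattern_at /= !inordK ?ltnS.
exists (fun z => [ffun i => u i (z (p i))]); split; first split.
- move=> z w /ffunP h; apply/ffunP => i; have := h ((p^-1)%g i).
  by rewrite !ffunE permKV => /perm_inj.
- by apply/ffunP => i; rewrite ffunE; have [] := hu i.
- move=> z w; rewrite /hdist [RHS](reindex_inj (@perm_inj _ p)) /=; apply: eq_bigr => i _.
  by rewrite !ffunE (inj_eq perm_inj).
- by apply/ffunP => i; rewrite ffunE; have [] := hu i.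
- by apply/ffunP => i; rewrite ffunE; have [] := hu i.
Qed.

Definition orbit_mx (t : n.+1.-tuple 'I_d.+1) : 'M[R]_N :=
  \matrix_(i, j) (pattern_count (enum_val i) (enum_val j) == t)%:R.

Definition pattern_counts := [set t : n.+1.-tuple 'I_d.+1 | (\sum_(i <- t) i)%N == d]%SET.

Definition orbit_span : {vspace 'M[R]_N} := <<[seq orbit_mx t | t <- enum pattern_counts]>>%VS.

(** The number of ways to write d as an ordered sum of n + 1 natural numbers is C(n + d, n). *)
Lemma orbit_span_dim : (\dim orbit_span <= 'C(n + d, n))%N.
Proof.
rewrite -card_ord_partitions; apply: leq_trans (dim_span _) _.
by rewrite size_map -cardE.
Qed.

Lemma invariant_orbit_span M : invariant M -> M \in orbit_span.
Proof.
move=> hM.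
pose c t := if [pick u : V * V | pattern_count u.1 u.2 == t] is Some u
            then M (enum_rank u.1) (enum_rank u.2) else 0.
have -> : M = \sum_(t in pattern_counts) c t *: orbit_mx t.
  apply/matrixP => i j; rewrite summxE -(enum_valK i) -(enum_valK j).
  set x := enum_val i; set y := enum_val j.
  rewrite (bigD1 (pattern_count x y)) /=; last by rewrite inE pattern_count_sum.
  rewrite !mxE !enum_rankK eqxx mulr1 big1 ?addr0 => [|t /andP [_ ne]]; last first.
    by rewrite !mxE !enum_rankK eq_sym (negbTE ne) mulr0.
  rewrite /c; case: pickP => [[x' y'] /= /eqP e|/(_ (x, y))]; last by rewrite eqxx.
  by have [g [hg <- <-]] := pattern_count_isometry e; rewrite hM.
apply: memv_suml => t ht; apply/memvZ/memv_span/map_f.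
by rewrite mem_enum.
Qed.

End OrbitSpan.

(** * Block sizes and their sum of squares *)

(** Types (r, j) of modules; those that do not occur get blocks of size 0. *)
Definition label d := ('I_d.+1 * 'I_d.+1)%type.
Definition valid d q (p : label d) : bool :=
  (p.1 + 2 * p.2 <= d)%N && ((q <= 2)%N ==> (p.1 == 0%N :> nat)).
Definition bsize d q (p : label d) : nat :=
  if valid q p then (d - p.1 - 2 * p.2).+1 else 0.

Lemma bin2_succ_sum m : ('C(m, 2) + 'C(m.+1, 2) = m ^ 2)%N.
Proof.
elim: m => [//|m IH]; rewrite [X in (_ + X)%N]binS bin1.
have := binS m 1; rewrite bin1; lia.
Qed.

(** Splitting off j = 0 relates n + 2 to n, and C(n + 5, 3) - C(n + 3, 3) = C(n + 3, 2) + C(n +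
    4, 2) = (n + 3) ^ 2. *)
Lemma sum_odd_squares D n : (n <= D)%N ->
  (\sum_(0 <= j < D.+1) (if 2 * j <= n then (n - 2 * j).+1 ^ 2 else 0) = 'C(n + 3, 3))%N.
Proof.
elim/ltn_ind: n D => n IH D nD; rewrite big_nat_recl //= muln0 subn0.
case: n IH nD => [|[|n]] IH nD.
- by rewrite big1_seq // => j _; rewrite mulnS.
- by rewrite big1_seq // => j _; rewrite mulnS.
case: D nD => // D nD.
rewrite (eq_bigr (fun j => if (2 * j <= n)%N then ((n - 2 * j).+1 ^ 2)%N else 0%N)) => [|j _];
  last first.
  by rewrite mulnS !add2n !ltnS !subSS.
have nD' : (n <= D)%N by lia.
rewrite IH //.
have e : (n.+2 + 3 = (n + 3).+2)%N by lia.
rewrite e (binS (n + 3).+1 2) (binS (n + 3) 2).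
have := bin2_succ_sum (n + 3); rewrite (_ : n.+3 = n + 3)%N; lia.
Qed.

Lemma sum_bin3 d : (\sum_(0 <= r < d.+1) 'C(d - r + 3, 3) = 'C(d + 4, 4))%N.
Proof.
elim: d => [|d IH]; first by rewrite big_nat1.
rewrite big_nat_recl // subn0; under eq_bigr do rewrite subSS.
by rewrite IH (_ : d.+1 + 4 = (d + 4).+1)%N // binS addnC; congr (_ + 'C(_, _))%N; lia.
Qed.

(** The left-hand side is the dimension of the direct sum of the blocks, the right-hand side
    bounds the dimension of T(a) from above by [orbit_span_dim]. Summing over j first gives C(d
    - r + 3, 3), and the sum over r is a hockey-stick sum. *)
Lemma sum_bsize_sq d q :
  (\sum_(p : label d) bsize q p ^ 2)%N =
  let n := if (q <= 2)%N then 3 else 4 in 'C(n + d, n).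
Proof.
have inner (r : 'I_d.+1) : (\sum_(j < d.+1) bsize q (r, j) ^ 2)%N =
   if (q <= 2)%N ==> (r == 0%N :> nat) then 'C(d - r + 3, 3) else 0%N.
  rewrite /bsize /valid /=; case: (_ ==> _) => /=; last first.
    by apply: big1 => j _; rewrite andbF.
  rewrite -(sum_odd_squares (D := d)) ?leq_subr // big_mkord; apply: eq_bigr => j _.
  rewrite andbT (_ : (r + 2 * j <= d)%N = (2 * j <= d - r)%N); first by case: ifP.
  by have := ltn_ord r; lia.
rewrite -(pair_big predT predT (fun r j => bsize q (r, j) ^ 2)%N) /=.
under eq_bigr do rewrite inner.
case: ifP => q2 /=.
  rewrite (bigD1 ord0) //= big1 => [|r ne]; last by rewrite (_ : _ == _ = false) //; apply/negbTE.
  by rewrite subn0 addn0 addnC.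
by rewrite -(big_mkord predT (fun r => 'C(d - r + 3, 3))) sum_bin3 addnC.
Qed.

(** * The blocks of the adjacency matrix and their generation *)

Section BlockMatrices.
Variables (R : realType) (d q : nat).
Local Notation T := (mxsum R (bsize q : label d -> nat)).

(** The matrix of A on v_0, ..., v_m, as computed in [adj_module_vec]. *)
Definition tri_entry (r j k l : nat) : R :=
  (l == k.+1)%:R * k.+1%:R + (l == k)%:R * ((q%:R - 2) * (k%:R + j%:R) - r%:R) +
  (k == l.+1)%:R * ((q%:R - 1) * (d%:R - r%:R - 2 * j%:R - k%:R + 1)).

Definition block_adj : T := [ffun p : label d => \matrix_(k, l) tri_entry p.1 p.2 k l].
(** The image of E_w^*, since v_k lives at distance r + j + k from the root. *)
Definition block_weight (w : nat) : T :=
  [ffun p : label d => \matrix_(k, l) ((k == l) && (p.1 + p.2 + k == w)%N)%:R].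

Lemma block_adjE p k l : block_adj p k l = tri_entry p.1 p.2 k l. Proof. by rewrite ffunE mxE. Qed.
Lemma block_weightE w p k l : block_weight w p k l = ((k == l) && (p.1 + p.2 + k == w)%N)%:R.
Proof. by rewrite ffunE mxE. Qed.

Lemma tri_entry_far r j k l : (k.+1 < l)%N || (l.+1 < k)%N -> tri_entry r j k l = 0.
Proof.
move=> h; rewrite /tri_entry.
have -> : (l == k.+1) = false by lia.
have -> : (l == k) = false by lia.
have -> : (k == l.+1) = false by lia.
by rewrite !mul0r !addr0.
Qed.
Lemma tri_entry_up r j k : tri_entry r j k k.+1 = k.+1%:R.
Proof.
rewrite /tri_entry eqxx.
have -> : (k.+1 == k) = false by lia.
have -> : (k == k.+2) = false by lia.
by rewrite !mul0r !addr0 mul1r.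
Qed.
Lemma tri_entry_diag r j k : tri_entry r j k k = (q%:R - 2) * (k%:R + j%:R) - r%:R.
Proof.
rewrite /tri_entry eqxx.
have -> : (k == k.+1) = false by lia.
by rewrite !mul0r addr0 add0r mul1r.
Qed.
Lemma tri_entry_down r j k : tri_entry r j k.+1 k = (q%:R - 1) * (d%:R - r%:R - 2 * j%:R - k%:R).
Proof.
rewrite /tri_entry eqxx.
have -> : (k == k.+2) = false by lia.
have -> : (k == k.+1) = false by lia.
by rewrite !mul0r !add0r mul1r -[k.+1]addn1 natrD; ring.
Qed.

Lemma valid_size (p : label d) : (0 < bsize q p)%N -> valid q p.
Proof. by rewrite /bsize; case: ifP. Qed.

Lemma in_block (p : label d) k : (k < bsize q p)%N -> (p.1 + 2 * p.2 + k <= d)%N.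
Proof.
rewrite /bsize; case: ifP => // /andP [h _]; rewrite ltnS; lia.
Qed.

Lemma tridiag_block_adj p : (1 < q)%N -> tridiag (block_adj p).
Proof.
move=> q1 k l; rewrite block_adjE; split; first exact: tri_entry_far.
case/orP => /eqP e.
  by rewrite e tri_entry_up pnatr_eq0.
rewrite e tri_entry_down mulf_neq0 //; first by rewrite subr_eq0 pnatr_eq1; lia.
have := in_block (ltn_ord k); rewrite e => h.
have -> : d%:R - p.1%:R - 2 * p.2%:R - l%:R = d%:R - (p.1 + 2 * p.2 + l)%N%:R :> R.
  by rewrite (natrD _ _ l) (natrD _ p.1) natrM; ring.
by rewrite subr_eq0 eqr_nat eq_sym ltn_eqF //; move: h; rewrite addnS.
Qed.
End BlockMatrices.

Section Sandwich.
Variables (R : fieldType) (P : finType) (s : P -> nat).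
Lemma sandwich00 (Q : pred P) (x : mxsum R s) (c : P -> R) :
  (forall p (h : (0 < s p)%N), Q p -> x p (Ordinal h) (Ordinal h) = c p) ->
  (\sum_(p | Q p) munit R s p 0 0) * x * (\sum_(p | Q p) munit R s p 0 0) =
  \sum_(p | Q p) c p *: munit R s p 0 0.
Proof.
move=> hc.
have E (y : mxsum R s) p i j (h : (0 < s p)%N) :
    ((\sum_(p | Q p) munit R s p 0 0) * y) p i j = (Q p && (i == 0%N :> nat))%:R * y p (Ordinal
      h) j.
  rewrite big_distrl /= mxsum_sume; under eq_bigr do rewrite (mul_munit _ _ _ _ _ h).
  case Qp : (Q p) => /=.
    rewrite (bigD1 p) //= eqxx /= big1 ?addr0 // => p' /andP [_ ne].
    by rewrite eq_sym (negbTE ne) mul0r.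
  rewrite mul0r big1 // => p' Q'; case: eqVneq => [e|]; last by rewrite mul0r.
  by rewrite e Q' in Qp.
have E' (y : mxsum R s) p i j (h : (0 < s p)%N) :
    (y * (\sum_(p | Q p) munit R s p 0 0)) p i j = (Q p && (j == 0%N :> nat))%:R * y p i (Ordinal
      h).
  rewrite big_distrr /= mxsum_sume; under eq_bigr do rewrite (mulx_munit _ _ _ _ _ h).
  case Qp : (Q p) => /=.
    rewrite (bigD1 p) //= eqxx /= big1 ?addr0 // => p' /andP [_ ne].
    by rewrite eq_sym (negbTE ne) mul0r.
  rewrite mul0r big1 // => p' Q'; case: eqVneq => [e|]; last by rewrite mul0r.
  by rewrite e Q' in Qp.
apply: mxsumP => p i j; have h : (0 < s p)%N by apply: leq_ltn_trans (ltn_ord i).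
rewrite (E' _ _ _ _ h) (E _ _ _ _ h) mxsum_sume.
under eq_bigr do rewrite mxsumZe munitE.
case Qp : (Q p) => /=.
  rewrite (bigD1 p) //= eqxx /= big1 ?addr0 => [|p' /andP [_ ne]]; last first.
    by rewrite eq_sym (negbTE ne) mulr0.
  rewrite hc //; case: (_ == _); case: (_ == _); rewrite /= ?mulr0 ?mul0r ?mulr1 ?mul1r //.
rewrite mul0r big1 // => p' Q'; case: eqVneq => [e|] /=; last by rewrite mulr0.
by rewrite e Q' in Qp.
Qed.
End Sandwich.

Section Generation.
Variables (R : realType) (d q : nat).
Hypothesis q1 : (1 < q)%N.
Local Notation s := (bsize q : label d -> nat).
Local Notation T := (mxsum R s).

(** By induction on the distance w at which a type starts. Once the types starting below w are
    known, subtracting their units from E_w^* leaves the sum X of the units munit p 0 0 over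
    the types starting at w. In X A X the coefficient of type (r, j) is (q - 2) j - r = (q - 2)
    w - (q - 1) r, which separates these types. *)
Lemma units_of_weights (S : set T) : msubalg S -> S (block_adj R d q) -> (forall w, S
  (block_weight R d q w)) ->
  forall p k l, (k < s p)%N -> (l < s p)%N -> S (munit R s p k l).
Proof.
move=> hS ST SW.
suff bottom w (p : label d) : (p.1 + p.2 = w)%N -> (0 < s p)%N -> S (munit R s p 0 0).
  move=> p k l hk hl; apply: (tridiag_krylov hS (@tridiag_block_adj R d q p q1) ST) => //.
  by apply: (bottom _ p erefl); apply: leq_ltn_trans hk.
elim/ltn_ind: w p => w IH p ep sp.
pose Q : pred (label d) := fun p => (p.1 + p.2 == w)%N && (0 < s p)%N.
(* The types starting below w whose module reaches distance w. *)
pose below (p : label d) := (p.1 + p.2 < w)%N && (w - p.1 - p.2 < s p)%N.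
have eX : \sum_(p | Q p) munit R s p 0 0 =
    block_weight R d q w - \sum_(p | below p) munit R s p (w - p.1 - p.2) (w - p.1 - p.2).
  apply: mxsumP => p' i j; rewrite mxsumBe block_weightE !mxsum_sume.
  have hi := ltn_ord i.
  have h0 : (0 < s p')%N by apply: leq_ltn_trans hi.
  have e (F : label d -> bool) (g : label d -> nat) :
      \sum_(p | F p) munit R s p (g p) (g p) p' i j =
      (F p' && (i == g p' :> nat) && (j == g p' :> nat))%:R.
    under eq_bigr do rewrite munitE.
    case Fp : (F p') => /=.
      rewrite (bigD1 p') //= eqxx big1 ?addr0 // => p1 /andP [_ ne].
      by rewrite eq_sym (negbTE ne).
    apply: big1 => p1 F1; case: eqVneq => // ep1; by rewrite ep1 F1 in Fp.
  have eQ := e Q (fun => 0%N).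
  have eb := e below (fun p : label d => (w - p.1 - p.2)%N).
  rewrite /= in eQ eb; rewrite eQ eb /Q /below h0 andbT.
  have -> : (i == j) = (i == j :> nat) by [].
  case: (ltngtP (p'.1 + p'.2) w) => /= hw.
  - case: (eqVneq (i : nat) j) => [<-|ij] /=; last first.
      rewrite sub0r; case: eqP; case: eqP; rewrite ?andbF ?oppr0 // => e1 e2.
      by rewrite e1 e2 eqxx in ij.
    have n1 (u v x : nat) : (u + v < w)%N -> (u + v + x == w)%N = (x == w - u - v)%N by lia.
    rewrite (n1 _ _ _ hw).
    by case: eqP => [<-|_]; rewrite ?andbF ?hi subrr.
  - have n2 (u v x : nat) : (w < u + v)%N -> (u + v + x == w)%N = false by lia.
    by rewrite subr0 (n2 _ _ _ hw) andbF.
  - have n3 (u v x : nat) : (u + v + x == u + v)%N = (x == 0)%N by lia.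
    rewrite subr0 -hw n3 andbC [RHS](_ : _ = ((j == 0%N :> nat) && (i == 0%N :> nat))%:R) //.
    by case: (eqVneq (i : nat) 0%N) => [->|]; rewrite ?andbT ?andbF // eq_sym.
have S1 : S (\sum_(p | Q p) munit R s p 0 0).
  rewrite eX; apply: msubB => //; apply: msub_sum => // p' /andP [h1 h2].
  apply: (tridiag_krylov hS (@tridiag_block_adj R d q p' q1) ST) => //.
  by apply: (IH _ h1 p' erefl); apply: leq_ltn_trans h2.
apply: (@munit00_separate _ _ _ _ hS Q (fun p => (q%:R - 2) * p.2%:R - p.1%:R)) => //.
- by move=> p' /andP [].
- move=> [r1 j1] [r2 j2]; rewrite !unfold_in /Q /= => /andP [/eqP e1 _] /andP [/eqP e2 _] /eqP.
  have -> : (j1 : nat) = (w - r1)%N by lia.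
  have -> : (j2 : nat) = (w - r2)%N by lia.
  rewrite !natrB; try lia.
  rewrite -subr_eq0 (_ : _ - _ = (q%:R - 1) * (r2%:R - r1%:R)); last by ring.
  rewrite mulf_eq0 !subr_eq0 eqr_nat pnatr_eq1 => /orP [|] /eqP e12; first by lia.
  by congr (_, _); apply: val_inj => /=; lia.
- rewrite -(sandwich00 (x := block_adj R d q)); first by do 2 apply: msubM => //.
  by move=> p' h _; rewrite block_adjE /= tri_entry_diag add0r.
by rewrite /Q unfold_in /= ep eqxx.
Qed.
End Generation.

(** * Matrix units of the Terwilliger algebra *)

Section Terwilliger.
Variables (R : realType) (d q : nat).
Hypothesis q1 : (1 < q)%N.
Local Notation V := {ffun 'I_d -> 'I_q}.
Local Notation N := #|{: V}|.
Local Notation s := (bsize q : label d -> nat).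
Local Notation T := (mxsum R s).
Variable a : V.
Local Notation A := (adjmx R (hamming d q)).
Local Notation Ew w := (Estar R (hamming d q) a w).

Lemma ex_neq_root : exists b : V, forall i, b i != a i.
Proof.
have exi i : exists u, u != a i.
  have /card_gt0P [u] : (0 < #|predC1 (a i)|)%N by rewrite cardC1 card_ord; move: q1; case: (q)
    => [|[|]].
  by rewrite !inE => h; exists u.
have [f hf] := fin_all_exists exi.
by exists [ffun i => f i] => i; rewrite ffunE.
Qed.

Lemma ex_third (b : V) : (2 < q)%N -> exists c : V, forall i, (c i != a i) && (c i != b i).
Proof.
move=> q2; have exi i : exists u, (u != a i) && (u != b i).
  have : (0 < #|[pred u : 'I_q | (u != a i) && (u != b i)]|)%N.
    have := cardC [pred u : 'I_q | (u != a i) && (u != b i)]; rewrite card_ord => e.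
    have h : (#|[predC [pred u : 'I_q | (u != a i) && (u != b i)]]| <= 2)%N.
      apply: leq_trans (_ : #|pred2 (a i) (b i)| <= 2)%N; last by rewrite card2; case: (_ != _).
      by apply: subset_leq_card; apply/fintype.subsetP => u; rewrite !inE negb_and !negbK.
    rewrite lt0n; apply/eqP => z; rewrite z add0n in e.
    by rewrite e leqNgt q2 in h.
  by case/card_gt0P => u hu; exists u.
have [f hf] := fin_all_exists exi.
by exists [ffun i => f i] => i; rewrite ffunE.
Qed.

Lemma gdist_weight x : gdist (hamming d q) a x = weight a x.
Proof. by rewrite gdist_hamming // hdist_sym. Qed.

(** The rows of the first matrix are the vectors v_k; the second matrix selects the witnesses.
    *)
Lemma ex_intertwiner (p : label d) : exists FG : 'M[R]_(s p, N) * 'M[R]_(N, s p),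
  [/\ FG.1 *m FG.2 = 1%:M, FG.1 *m A = block_adj R d q p *m FG.1 &
      forall w, FG.1 *m Ew w = block_weight R d q w p *m FG.1].
Proof.
(* A type that does not occur has a block of size 0. *)
case: (boolP (valid q p)) => [vp|nv]; last first.
  have s0 : s p = 0%N by rewrite /bsize (negbTE nv).
  exists (0, 0); split => [||w]; apply/matrixP => i; exfalso; by have := leq_trans (ltn_ord i)
    (eq_leq s0).
move: (vp) => /andP [hd hq].
set r := (p.1 : nat) in hd hq *; set j := (p.2 : nat) in hd *.
pose m := (d - r - 2 * j)%N.
have sE : s p = m.+1 by rewrite /bsize vp.
have [b hb] := ex_neq_root.
have [c hc] : exists c : V, (0 < r)%N -> forall i, (c i != a i) && (c i != b i).
  case: (posnP r) => [|r0]; first by exists a.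
  have [|c hc] := ex_third b; last by exists c.
  by move: hq; case: leqP => //= _; lia.
(* Any bijection from the four kinds of positions onto the positions will do. *)
pose K := (('I_r + 'I_j) + ('I_j + 'I_m))%type.
have eK : #|{: K}| = #|'I_d|.
  by rewrite !card_sum !card_ord /m; move: hd; clear; lia.
pose phi (k : K) : 'I_d := enum_val (cast_ord eK (enum_rank k)).
pose psi (i : 'I_d) : K := enum_val (cast_ord (esym eK) (enum_rank i)).
have phiK : cancel phi psi by move=> k; rewrite /psi /phi enum_valK cast_ordK enum_rankK.
have psiK : cancel psi phi by move=> k; rewrite /psi /phi enum_valK cast_ordKV enum_rankK.
pose v k x : R := module_vec R a b c phi k x.
have act k x : \sum_y (hamming d q x y)%:R * v k y = (k.+1)%:R * v k.+1 x +
   ((q%:R - 2) * (k%:R + j%:R) - r%:R) * v k x +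
   (0 < k)%:R * ((q%:R - 1) * (m%:R - k%:R + 1) * v k.-1 x).
  exact: (adj_module_vec R a b c phiK psiK).
have vwt k x : v k x != 0 -> weight a x = (r + j + k)%N by apply: (module_vec_weight phiK psiK hb
  hc).
have vm k x : (m < k)%N -> v k x = 0.
  move=> mk; rewrite /v /module_vec (_ : (free_weight _ _ _ == k) = false) ?mulr0 //.
  by apply/negbTE; rewrite neq_ltn (leq_ltn_trans (free_weight_le _ _ _) mk).
have vwit k l : (k <= m)%N -> v l (witness a b psi k) = (l == k)%:R.
  by apply: module_vec_witness.
have mE : m%:R = d%:R - r%:R - 2 * j%:R :> R.
  by rewrite /m !natrB ?natrM //; lia.
clearbody v.
exists (\matrix_(k, i) v k (enum_val i), \matrix_(i, k) (i == enum_rank (witness a b psi k))%:R).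
split => /=.
- apply/matrixP => k l; rewrite !mxE (bigD1 (enum_rank (witness a b psi l))) //= big1 ?addr0.
    rewrite !mxE eqxx mulr1 enum_rankK vwit ?(inj_eq (@ord_inj _)) //.
    by rewrite -ltnS; apply: leq_trans (ltn_ord l) (eq_leq sE).
  by move=> i ne; rewrite !mxE (negbTE ne) mulr0.
- apply/matrixP => k i; rewrite !mxE.
  under [RHS]eq_bigr do rewrite block_adjE mxE -/r -/j.
  rewrite sum_enum_rank. under [LHS]eq_bigr do rewrite !mxE !enum_rankK hammingE hdist_sym
    -hammingE mulrC.
  rewrite act.
  transitivity (\sum_(l < s p) (l == k.+1 :> nat)%:R * ((k.+1)%:R * v l (enum_val i)) +
     \sum_(l < s p) (l == k :> nat)%:R * (((q%:R - 2) * (k%:R + j%:R) - r%:R) * v l (enum_val i)) +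
     \sum_(l < s p) (k == l.+1 :> nat)%:R * (((q%:R - 1) * (d%:R - r%:R - 2 * j%:R - k%:R + 1)) *
       v l (enum_val i))).
    rewrite (sum_pick _ (fun l => (k.+1)%:R * v l (enum_val i))).
    rewrite (sum_pick _ (fun l => ((q%:R - 2) * (k%:R + j%:R) - r%:R) * v l (enum_val i))) ltn_ord.
    congr (_ + _ + _).
      case: ltnP => // h; rewrite vm ?mulr0 //.
      by rewrite -ltnS; apply: leq_trans (eq_leq (esym sE)) h.
    rewrite -mE; case: (k : nat) (ltn_ord k) => [|k'] hk /=.
      by rewrite mul0r big1 // => l _; rewrite mul0r.
    under eq_bigr do rewrite eqSS eq_sym.
    rewrite (sum_pick _ (fun l => (q%:R - 1) * (m%:R - k'.+1%:R + 1) * v l (enum_val i))).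
    by rewrite (ltnW hk) mul1r.
  rewrite -!big_split /=; apply: eq_bigr => l _.
  by rewrite /tri_entry; ring.
- move=> w; apply/matrixP => k i; rewrite mul_mx_diag !mxE.
  under [RHS]eq_bigr do rewrite block_weightE mxE.
  rewrite gdist_weight (bigD1 k) //= eqxx /= big1 ?addr0 => [|l ne]; last first.
    by rewrite eq_sym (negbTE ne) mul0r.
  rewrite mulrC; case: (eqVneq (v k (enum_val i)) 0) => [->|nz]; first by rewrite !mulr0.
  by rewrite (vwt _ _ nz).
Qed.

Definition intertwiner p := (projT1 (cid (ex_intertwiner p))).1.
Definition intertwiner_inv p := (projT1 (cid (ex_intertwiner p))).2.
Lemma intertwinerK p : intertwiner p *m intertwiner_inv p = 1%:M.
Proof. by rewrite /intertwiner /intertwiner_inv; case: cid => ? []. Qed.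
Lemma intertwiner_adj p : intertwiner p *m A = block_adj R d q p *m intertwiner p.
Proof. by rewrite /intertwiner /intertwiner_inv; case: cid => ? []. Qed.
Lemma intertwiner_Estar p w : intertwiner p *m Ew w = block_weight R d q w p *m intertwiner p.
Proof. by rewrite /intertwiner /intertwiner_inv; case: cid => ? []. Qed.

Definition rho (M : 'M[R]_N) : T := [ffun p : label d => intertwiner p *m M *m intertwiner_inv p].
Definition intertwined : set 'M[R]_N := [set M | forall p, intertwiner p *m M = rho M p *m
  intertwiner p].

(** Because the intertwiner is invertible on the right, x is determined by M. *)
Lemma rhoP (M : 'M[R]_N) (x : T) : (forall p, intertwiner p *m M = x p *m intertwiner p) ->
  rho M = x /\ intertwined M.
Proof.
move=> h; have e : rho M = x.
  by apply/ffunP => p; rewrite ffunE h -mulmxA intertwinerK mulmx1.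
by split => // p; rewrite e.
Qed.

Lemma rho1 : rho 1%:M = 1.
Proof. by apply/ffunP => p; rewrite !ffunE mulmx1 intertwinerK. Qed.
Lemma rho_linear c M M' : rho (c *: M + M') = c *: rho M + rho M'.
Proof.
by apply/ffunP => p; rewrite !ffunE mulmxDr mulmxDl -scalemxAr -scalemxAl.
Qed.
Lemma rhoM M M' : intertwined M -> rho (M *m M') = rho M * rho M'.
Proof. by move=> h; apply/ffunP => p; rewrite [RHS]ffunE ![rho _ p in LHS]ffunE mulmxA h [X in _
  = _ *m X]ffunE !mulmxA. Qed.

Lemma intertwined_sub : is_subalgebra intertwined.
Proof.
split => [|c M M' h h'|M M' h h'].
- by apply: (rhoP (x := 1) _).2 => p; rewrite mulmx1 mxsum1E mul1mx.
- move=> p; rewrite rho_linear mxsumDE mxsumZE mulmxDr mulmxDl -scalemxAr -scalemxAl.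
  by rewrite (h p) (h' p).
- by move=> p; rewrite rhoM // mxsumME mulmxA h -!mulmxA h'.
Qed.

Local Notation terw := (terwilliger R V (hamming d q) a).

Lemma terw_adj : terw A.
Proof. by apply: gen_alg_incl; left. Qed.

Lemma terw_Estar w : terw (Ew w).
Proof.
case: (leqP w (eccentricity (hamming d q) a)) => h.
  by apply: gen_alg_incl; right; exists w.
have -> : Ew w = 0.
  apply/matrixP => i k; rewrite !mxE (_ : (gdist _ _ _ == w) = false) ?mul0rn //.
  by apply/negbTE; rewrite neq_ltn (leq_ltn_trans (leq_bigmax _) h).
have [h1 hl _] := gen_algP (R := R) [set M | M = A \/ exists2 i, (i <= eccentricity (hamming d q)
  a)%N & M = Ew i].
by have := hl (-1) _ _ h1 h1; rewrite scaleN1r addNr.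
Qed.

Lemma terw_intertwined M : terw M -> intertwined M.
Proof.
apply: gen_alg_sub intertwined_sub _ M => M [->|[w _ ->]].
  exact: (rhoP (x := block_adj R d q) intertwiner_adj).2.
exact: (rhoP (x := block_weight R d q w) (intertwiner_Estar^~ w)).2.
Qed.

Lemma rho_adj : rho A = block_adj R d q. Proof. exact: (rhoP intertwiner_adj).1. Qed.
Lemma rho_Estar w : rho (Ew w) = block_weight R d q w. Proof. exact: (rhoP (x := block_weight R d
  q w) (intertwiner_Estar^~ w)).1. Qed.

Lemma terw_sub : is_subalgebra terw. Proof. exact: gen_algP. Qed.

Lemma rho_onto p k l : (k < s p)%N -> (l < s p)%N ->
  exists2 M, terw M & rho M = munit R s p k l.
Proof.
move=> hk hl; have [t1 tl tm] := terw_sub.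
apply: (@units_of_weights R d q q1 [set x | exists2 M, terw M & rho M = x]) => //.
- split.
  + by exists 1%:M; rewrite ?rho1.
  + by move=> c _ _ [M hM <-] [M' hM' <-]; exists (c *: M + M'); rewrite ?rho_linear //; apply: tl.
  + move=> _ _ [M hM <-] [M' hM' <-]; exists (M *m M'); first exact: tm.
    by rewrite rhoM //; apply: terw_intertwined.
- by exists A; [exact: terw_adj|exact: rho_adj].
- by move=> w; exists (Ew w); [exact: terw_Estar|exact: rho_Estar].
Qed.

Lemma terw_invariant M : terw M -> invariant a M.
Proof.
apply: gen_alg_sub (invariant_sub R a) _ M => M [->|[w _ ->]]; first exact: invariant_adj.
have -> : Ew w = diagmx R (fun x : V => hdist a x == w).
  by apply/matrixP => i k; rewrite !mxE gdist_hamming.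
exact: (@invariant_diag R d q a (fun k => k == w)).
Qed.

(** Preimages of the matrix units under rho span a space of dimension the sum of the squares of
    the block sizes. It lies in the span of the orbit matrices, which is no larger, so it is
    T(a), and rho is injective on T(a). *)
Theorem terwilliger_units : exists U : label d -> nat -> nat -> 'M[R]_N,
  [/\ unit_system s U, forall p k l, (k < s p)%N -> (l < s p)%N -> terw (U p k l),
      range (emb (s := s) U) = terw, emb (s := s) U 1 = 1%:M &
      emb (s := s) U (block_adj R d q) = A /\ forall w, emb (s := s) U (block_weight R d q w) =
        Ew w].
Proof.
have eproj_U p k l : exists M, (k < s p)%N -> (l < s p)%N -> terw M /\ rho M = munit R s p k l.
  case: (boolP ((k < s p)%N && (l < s p)%N)) => [/andP [hk hl]|].
    by have [M h1 h2] := rho_onto hk hl; exists M.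
  by move=> h; exists 0 => hk hl; rewrite hk hl in h.
pose U p k l := projT1 (cid (eproj_U p k l)).
have hU p k l : (k < s p)%N -> (l < s p)%N -> terw (U p k l) /\ rho (U p k l) = munit R s p k l.
  by rewrite /U; case: cid.
have tU p k l hk hl := (hU p k l hk hl).1.
have rU p k l hk hl := (hU p k l hk hl).2.
have embT x : terw (emb (s := s) U x) by apply: emb_in_sub terw_sub tU x.
have rho0 : rho 0 = 0 by apply/ffunP => p; rewrite !ffunE mulmx0 mul0mx.
have rhoD M M' : rho (M + M') = rho M + rho M'.
  by have := rho_linear 1 M M'; rewrite !scale1r.
have rhoZ c M : rho (c *: M) = c *: rho M.
  by have := rho_linear c M 0; rewrite !addr0 rho0 addr0.
have rhoemb x : rho (emb (s := s) U x) = x.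
  elim/(@mxsum_ind R _ s): x => [|x y hx hy|c p k l hk hl].
  - by rewrite emb0.
  - by rewrite embD rhoD hx hy.
  - by rewrite embZ rhoZ emb_munit // rU.
have einj : injective (emb (s := s) U) by apply: can_inj rhoemb.
have [W0 eW dW] := emb_dim einj.
(* Two letters cannot realise the pattern of three distinct ones. *)
have pat_le (u v w : 'I_q) : (pattern3 u v w <= if (q <= 2)%N then 3 else 4)%N.
  rewrite /pattern3; case: (leqP q 2) => q2; last by case: (v == u); case: (w == u); case: (v == w).
  case: eqP => vu; case: eqP => wu //; case: eqP => vw //; exfalso.
  move: vu wu vw => /eqP + /eqP + /eqP; rewrite -!(inj_eq (@ord_inj _)).
  by have := ltn_ord u; have := ltn_ord v; have := ltn_ord w; lia.
(* The two dimensions agree by [sum_bsize_sq], so the inclusion is an equality. *)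
have WO : W0 = @orbit_span R d q (if (q <= 2)%N then 3 else 4) a.
  apply/eqP; rewrite eqEdim; apply/andP; split.
    apply/subvP => M hM; apply: (invariant_orbit_span pat_le); apply: terw_invariant.
    have : [set M | M \in W0]%classic M by [].
    by rewrite -eW => -[x _ <-].
  rewrite dW sum_bsize_sq; exact: orbit_span_dim.
have onto M : terw M -> exists x, M = emb (s := s) U x.
  move=> hM; have : M \in W0 by rewrite WO; apply: (invariant_orbit_span pat_le); apply:
    terw_invariant.
  by move=> h; have : [set M | M \in W0]%classic M by []; rewrite -eW => -[x _ <-]; exists x.
have rho_inj M M' : terw M -> terw M' -> rho M = rho M' -> M = M'.
  by move=> /onto [x ->] /onto [y ->]; rewrite !rhoemb => ->.
have [t1 tl tm] := terw_sub.
have t0 : terw 0 by have := tl (-1) _ _ t1 t1; rewrite scaleN1r addNr.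
have tZ c M : terw M -> terw (c *: M) by move=> hM; rewrite -[_ *: _]addr0; apply: tl.
exists U; split => //.
- split.
    move=> p p' k l k' l' hk hl hk' hl'.
    apply: rho_inj.
    + by apply: tm; apply: tU.
    + case: (eqVneq p p') => [e|_] /=; last by rewrite scale0r.
      by subst p'; apply: tZ; apply: tU.
    rewrite rhoM; last by apply: terw_intertwined; apply: tU.
    rewrite !rU // munitM // rhoZ; case: (eqVneq p p') => [e|_] /=; last by rewrite !scale0r.
    by subst p'; rewrite rU.
  move=> p k hk; apply/eqP => U0; have := rU p k k hk hk; rewrite U0 rho0.
  move=> /(congr1 (fun x : T => x p (Ordinal hk) (Ordinal hk))).
  by rewrite munitE mxsum0E mxE !eqxx => /eqP; rewrite eq_sym oner_eq0.
- apply/seteqP; split => [_ [x _ <-]|M /onto [x ->]]; last by exists x.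
  exact: embT.
- by apply: rho_inj => //; rewrite rhoemb rho1.
- split; first by apply: rho_inj; rewrite ?rhoemb ?rho_adj //; apply: terw_adj.
  by move=> w; apply: rho_inj; rewrite ?rhoemb ?rho_Estar //; apply: terw_Estar.
Qed.

End Terwilliger.

(** * The corner *)

Section Corner.
Variables (R : realType) (d q : nat).
Hypothesis q1 : (1 < q)%N.
Local Notation V := {ffun 'I_d -> 'I_q}.
Variable a : V.
Local Notation N := #|{: V}|.
Local Notation N' := #|vdel a|.
Local Notation s := (bsize q : label d -> nat).

(** The shift of the indices of the block of type (0, 0), which loses its first basis vector,
    supported at the root. *)
Definition off (p : label d) : nat := (p.1 + p.2 == 0)%N.
Definition csize (p : label d) : nat := (bsize q p - off p)%N.
Local Notation s' := (csize : label d -> nat).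

Definition cblock_adj : mxsum R s' :=
  [ffun p : label d => \matrix_(k, l) tri_entry R d q p.1 p.2 (k + off p) (l + off p)].
Definition cblock_nbr : mxsum R s' :=
  [ffun p : label d => \matrix_(k, l) ((k == l) && (p.1 + p.2 + (k + off p) == 1)%N)%:R].

Fact shift_proof p (k : 'I_(csize p)) : (k + off p < bsize q p)%N.
Proof. by rewrite addnC -ltn_subRL. Qed.
Definition shift p (k : 'I_(csize p)) : 'I_(bsize q p) := Ordinal (shift_proof k).
(** The counterpart of the compression on the block side: remove the first row and column of
    the block of type (0, 0). *)
Definition shrink (x : mxsum R s) : mxsum R s' :=
  [ffun p : label d => \matrix_(k, l) x p (shift k) (shift l)].
Lemma shrinkE x p k l : shrink x p k l = x p (shift k) (shift l).
Proof. by rewrite ffunE mxE. Qed.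

Local Notation Ew w := (Estar R (hamming d q) a w).
Local Notation eproj := (1%:M - Ew 0).
Local Notation cp := (compress a).

Lemma sum_vdel (F : V -> R) : \sum_(i < N') F (val (enum_val i)) = \sum_(x | x != a) F x.
Proof.
transitivity (\sum_(x : vdel a) F (val x)).
  rewrite [RHS](reindex (fun i : 'I_N' => enum_val i)) //.
  by exists enum_rank => ? _; rewrite ?enum_valK ?enum_rankK.
rewrite [RHS](reindex_omap (fun x : vdel a => val x) insub) /=; last first.
  by move=> x hx; rewrite insubT.
by apply: eq_bigl => x; rewrite valK eqxx (valP x).
Qed.

Lemma compress0 : cp (0 : 'M[R]_N) = 0.
Proof. by apply/matrixP => i j; rewrite !mxE. Qed.
Lemma compressD M M' : cp (M + M') = cp M + cp M' :> 'M[R]_N'.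
Proof. by apply/matrixP => i j; rewrite !mxE. Qed.
Lemma compressZ c M : cp (c *: M) = c *: cp M :> 'M[R]_N'.
Proof. by apply/matrixP => i j; rewrite !mxE. Qed.

Lemma compress1 : cp (1%:M : 'M[R]_N) = 1%:M.
Proof.
apply/matrixP => i j; rewrite !mxE (inj_eq enum_rank_inj) (inj_eq val_inj).
by rewrite (inj_eq enum_val_inj).
Qed.

Lemma eprojE : eproj = diagmx R (fun x : V => x != a).
Proof.
apply/matrixP => i j; rewrite !mxE gdist_hamming // hdist_eq0 [a == _]eq_sym.
by case: (i == j); case: (enum_val i == a); rewrite /= ?mulr1n ?mulr0n ?subr0 ?subrr.
Qed.

(** Compressing is multiplicative as soon as the sum over the intermediate vertex skips the
    root. *)
Lemma compressM M M' : cp (M *m eproj *m M') = cp M *m cp M' :> 'M[R]_N'.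
Proof.
apply/matrixP => i j; rewrite !mxE.
under [RHS]eq_bigr do rewrite !mxE.
rewrite eprojE; set xi := enum_rank _; set xj := enum_rank _.
rewrite (sum_vdel (fun x => M xi (enum_rank x) * M' (enum_rank x) xj)).
rewrite sum_enum_rank [RHS]big_mkcond; apply: eq_bigr => x _.
rewrite mul_mx_diag !mxE enum_rankK.
by case: (x != a); rewrite ?mulr1 // mulr0 mul0r.
Qed.

Lemma compress_eproj M : cp (eproj *m M *m eproj) = cp M :> 'M[R]_N'.
Proof.
have h1 : eproj *m M *m eproj = 1%:M *m eproj *m (M *m eproj) by rewrite mul1mx mulmxA.
have h2 : cp (M *m eproj) = cp M *m cp 1%:M by rewrite -compressM mulmx1.
by rewrite h1 compressM h2 compress1 mul1mx mulmx1.
Qed.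

Lemma compress_inj M : eproj *m M *m eproj = M -> cp M = 0 -> M = 0.
Proof.
move=> <- h; apply/matrixP => i j; rewrite eprojE mul_mx_diag mul_diag_mx !mxE.
case: (boolP (enum_val i != a)) => hi; last by rewrite !mul0r.
case: (boolP (enum_val j != a)) => hj; last by rewrite mulr0.
have := congr1 (fun M : 'M_N' => M (enum_rank (Sub (enum_val i) hi : vdel a))
   (enum_rank (Sub (enum_val j) hj : vdel a))) h.
rewrite /compress mxE !enum_rankK !SubK !enum_valK eprojE mul_mx_diag mul_diag_mx !mxE.
by rewrite hi hj.
Qed.

Lemma shrink1 : shrink 1 = 1.
Proof.
by apply: mxsumP => p k l; rewrite shrinkE !mxsum1E !mxE -!val_eqE /= eqn_add2r.
Qed.

Lemma csizeP p k : (k < csize p)%N = (k + off p < bsize q p)%N.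
Proof. by rewrite /csize ltn_subRL addnC. Qed.

Lemma shrink_munit p k l : shrink (munit R s p k l) =
  if (off p <= k)%N && (off p <= l)%N then munit R s' p (k - off p) (l - off p) else 0.
Proof.
apply: mxsumP => p' i j; rewrite shrinkE munitE /=.
case: (eqVneq p' p) => [e|ne]; last first.
  by case: ifP => _; rewrite ?munitE ?(negbTE ne) // mxsum0E mxE.
subst p'; case: ifP => [/andP [hk hl]|/negbT]; rewrite /= ?munitE ?eqxx /=.
  by rewrite -(eqn_add2r (off p) i) -(eqn_add2r (off p) j) !subnK.
rewrite negb_and -!ltnNge mxsum0E mxE => /orP [h|h].
  by rewrite (_ : _ == k = false) //; apply/negbTE; rewrite neq_ltn (leq_trans h (leq_addl _ _))
    orbT.
by rewrite (_ : _ == l = false) ?andbF //; apply/negbTE; rewrite neq_ltn (leq_trans h (leq_addl _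
  _)) orbT.
Qed.

Lemma off_inj p p' : off p = 1%N -> off p' = 1%N -> p = p'.
Proof.
case: p p' => [r j] [r' j']; rewrite /off /= !addn_eq0.
case: (eqVneq (r : nat) 0%N) => // r0; case: (eqVneq (j : nat) 0%N) => // j0 _.
case: (eqVneq (r' : nat) 0%N) => // r'0; case: (eqVneq (j' : nat) 0%N) => // j'0 _.
by congr (_, _); apply: val_inj; rewrite /= ?r0 ?j0 ?r'0 ?j'0.
Qed.

(** The root projection E_0^* is the unit e_(00) of type (0, 0); all the units that it
    annihilates on both sides survive the compression. *)
Theorem corner_units : exists W : label d -> nat -> nat -> 'M[R]_N',
  [/\ unit_system s' W, range (emb (s := s') W) = corner R (hamming d q) a,
      emb (s := s') W 1 = 1%:M, emb (s := s') W cblock_adj = adjmx R (edel (hamming d q) a) &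
      emb (s := s') W cblock_nbr = diagmx R (fun x : vdel a => hamming d q a (val x))].
Proof.
have [U [usU tU rU U1 [UA UE]]] := terwilliger_units R q1 a.
pose p0 : label d := (ord0, ord0).
have s0 : (0 < s p0)%N by rewrite /bsize /valid /= implybT.
have W0E : block_weight R d q 0 = munit R s p0 0 0.
  apply: mxsumP => p k l; rewrite block_weightE munitE -(inj_eq (@ord_inj _)) !addn_eq0.
  case: p k l => [r j] k l /=; rewrite -pair_eqE /= -!(inj_eq (@ord_inj _)) /=.
  case: (r == 0%N :> nat); case: (j == 0%N :> nat); rewrite ?andbF //=.
  by case: (eqVneq (k : nat) 0%N) => [->|]; rewrite ?andbT ?andbF // eq_sym.
have E0 : Ew 0 = U p0 0%N 0%N by rewrite -UE W0E emb_munit.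
have off0 p k : (k < s p)%N -> (off p <= k)%N || ((p == p0) && (k == 0%N)).
  move=> hk; rewrite /off; case: (eqVneq (p.1 + p.2)%N 0%N) => //= e.
  have -> : p = p0 by apply: off_inj; rewrite /off ?e.
  by rewrite eqxx /=; case: k hk.
have eproj_l p k l : (k < s p)%N -> (l < s p)%N -> (off p <= k)%N -> eproj *m U p k l = U p k l.
  move=> hk hl ok; rewrite mulmxBl mul1mx E0 usU.1 //.
  case: (eqVneq p0 p) => [e|_]; last by rewrite scale0r subr0.
  by move: ok; rewrite -e; case: (k) => [|k'] //; rewrite scale0r subr0.
have eproj_r p k l : (k < s p)%N -> (l < s p)%N -> (off p <= l)%N -> U p k l *m eproj = U p k l.
  move=> hk hl ok; rewrite mulmxBr mulmx1 E0 usU.1 //.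
  case: (eqVneq p p0) => [e|_]; last by rewrite scale0r subr0.
  by move: ok; rewrite e; case: (l) => [|k'] //; rewrite scale0r subr0.
have eproj_U k l : (k < s p0)%N -> eproj *m U p0 0%N k = 0 /\ ((l < s p0)%N -> U p0 l 0%N *m
  eproj = 0).
  move=> hk; split => [|hl].
    by rewrite mulmxBl mul1mx E0 usU.1 // !eqxx scale1r subrr.
  by rewrite mulmxBr mulmx1 E0 usU.1 // !eqxx scale1r subrr.
pose W (p : label d) k l : 'M[R]_N' := cp (U p (k + off p)%N (l + off p)%N).
have WU x : cp (emb (s := s) U x) = emb (s := s') W (shrink x).
  elim/(@mxsum_ind R _ s): x => [|x y hx hy|c p k l hk hl].
  - rewrite emb0 compress0; have -> : shrink 0 = 0; last by rewrite emb0.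
    by apply: mxsumP => p k l; rewrite shrinkE !mxsum0E !mxE.
  - rewrite embD compressD hx hy -embD; congr (emb _ _).
    by apply: mxsumP => p k l; rewrite mxsumDe !shrinkE mxsumDe.
  - rewrite embZ compressZ emb_munit //.
    have -> : shrink (c *: munit R s p k l) = c *: shrink (munit R s p k l).
      by apply: mxsumP => p' k' l'; rewrite mxsumZe !shrinkE mxsumZe.
    rewrite embZ; congr (_ *: _); rewrite shrink_munit.
    case: (boolP (_ && _)) => [/andP [ok ol]|].
      by rewrite emb_munit ?csizeP ?subnK // /W !subnK.
    rewrite emb0 negb_and -compress_eproj => /orP [h|h].
      have := off0 _ _ hk; rewrite (negbTE h) /= => /andP [/eqP e /eqP e']; subst p k.
      by rewrite (eproj_U l 0%N hl).1 mul0mx compress0.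
    have := off0 _ _ hl; rewrite (negbTE h) /= => /andP [/eqP e /eqP e']; subst p l.
    by rewrite -mulmxA (eproj_U k k hk).2 // mulmx0 compress0.
have off_le p k : (off p <= k + off p)%N by apply: leq_addl.
exists W; split.
- split.
    move=> p p' k l k' l'; rewrite !csizeP => hk hl hk' hl'.
    rewrite /W -compressM -mulmxA eproj_l // usU.1 // compressZ.
    by case: (eqVneq p p') => [->|_]; rewrite ?eqn_add2r //= !scale0r.
  move=> p k; rewrite csizeP => hk; apply/eqP => /compress_inj h.
  have := usU.2 p _ hk; rewrite h ?eqxx //.
  by rewrite eproj_l ?eproj_r.
  apply/seteqP; split.
    move=> _ [y _ <-].
    have [x ->] : exists x, y = shrink x.
      elim/(@mxsum_ind R _ s'): y => [|_ _ [x1 ->] [x2 ->]|c p k l hk hl].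
      + by exists 0; apply: mxsumP => p k l; rewrite shrinkE !mxsum0E !mxE.
      + by exists (x1 + x2); apply: mxsumP => p k l; rewrite mxsumDe !shrinkE mxsumDe.
      + exists (c *: munit R s p (k + off p) (l + off p)).
        transitivity (c *: shrink (munit R s p (k + off p) (l + off p))).
          by rewrite shrink_munit !off_le !addnK.
        by apply: mxsumP => p' k' l'; rewrite mxsumZe !shrinkE mxsumZe.
    exists (emb (s := s) U x); first by rewrite -rU; exists x.
    by rewrite compress_eproj WU.
  move=> _ [M hM <-]; rewrite compress_eproj; move: hM; rewrite -rU => -[x _ <-].
  by rewrite WU; exists (shrink x).
- by rewrite -shrink1 -WU U1 compress1.
- have -> : cblock_adj = shrink (block_adj R d q).
    by apply: mxsumP => p k l; rewrite shrinkE block_adjE ffunE mxE.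
  rewrite -WU UA; apply/matrixP => i j; by rewrite !mxE !enum_rankK.
- have -> : cblock_nbr = shrink (block_weight R d q 1).
    apply: mxsumP => p k l; rewrite shrinkE block_weightE ffunE mxE /=.
    by congr (_ && _)%:R; rewrite -!val_eqE /= eqn_add2r.
  rewrite -WU UE; apply/matrixP => i j; rewrite !mxE !enum_rankK (inj_eq enum_rank_inj).
  by rewrite (inj_eq val_inj) (inj_eq enum_val_inj) hammingE gdist_hamming.
Qed.

End Corner.

(** * The spectrum of the blocks *)

Section HornerMatrix.
Variable R : fieldType.

(** Evaluation of a polynomial at a square matrix whose size may be 0. *)
Definition mx_eval n : 'M[R]_n -> {poly R} -> 'M[R]_n :=
  match n with 0 => fun _ _ => 0 | n'.+1 => fun M f => horner_mx M f end.

Lemma mx0_unique (M M' : 'M[R]_0) : M = M'.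
Proof. by apply/matrixP => -[]. Qed.

Lemma mx_eval_lin n (M : 'M[R]_n) c (f g : {poly R}) : mx_eval M (c *: f + g) = c *: mx_eval M f
  + mx_eval M g.
Proof. by case: n M => [|n] M; [apply: mx0_unique|rewrite /= linearP]. Qed.
Lemma mx_eval_mul n (M : 'M[R]_n) (f g : {poly R}) : mx_eval M (f * g) = mx_eval M f *m mx_eval M g.
Proof. by case: n M => [|n] M; [apply: mx0_unique|rewrite /= rmorphM]. Qed.
Lemma mx_eval1 n (M : 'M[R]_n) : mx_eval M 1 = 1%:M.
Proof. by case: n M => [|n] M; [apply: mx0_unique|rewrite /= rmorph1]. Qed.
Lemma mx_evalX n (M : 'M[R]_n) : mx_eval M 'X = M.
Proof. by case: n M => [|n] M; [apply: mx0_unique|rewrite /= horner_mx_X]. Qed.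

Lemma pow_tridiag n (M : 'M[R]_n.+1) : tridiag M -> forall k (l : 'I_n.+1),
  ((k < l)%N -> (M ^+ k) 0 l = 0) /\ (k = l :> nat -> (M ^+ k) 0 l != 0).
Proof.
move=> tri; elim=> [|k IH] l.
  rewrite expr0 mxE; split => [l0|l0].
    by rewrite -(inj_eq (@ord_inj _)) /=; move: l0; case: (l : nat).
  by rewrite -(inj_eq (@ord_inj _)) /= -l0 eqxx oner_neq0.
rewrite exprSr mxE; split => hl.
  rewrite big1 // => i _; case: (ltnP k i) => ki; first by rewrite (IH i).1 // mul0r.
  by case: (tri i l) => -> //; rewrite ?mulr0 //; apply/orP; left; apply: leq_ltn_trans hl.
have hk : (k < n.+1)%N by apply: ltn_trans (ltn_ord l); rewrite -hl.
rewrite (bigD1 (Ordinal hk)) //= big1 ?addr0.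
  apply: mulf_neq0; first by apply: (IH _).2.
  by case: (tri (Ordinal hk) l) => _; apply; rewrite /= hl eqxx.
move=> i ne; case: (ltngtP i k) => ik.
- by case: (tri i l) => -> //; rewrite ?mulr0 //; rewrite -hl ltnS ik.
- by rewrite (IH i).1 // mul0r.
by case/eqP: ne; apply: val_inj.
Qed.

(** The powers M^0, M^1, ... reach the entries (0, 0), (0, 1), ... one after the other, so a
    nonzero polynomial of degree at most n - 1 in M has a nonzero entry in its first row. *)
Lemma mx_eval_tridiag_eq0 n (M : 'M[R]_n) (f : {poly R}) : tridiag M -> (size f <= n)%N ->
  mx_eval M f = 0 -> f = 0.
Proof.
case: n M => [|n] M tri sf /=; first by move=> _; apply/eqP; rewrite -size_poly_eq0 -leqn0.
move=> h; apply/eqP; apply: contraT => nz.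
have sf0 : (0 < size f)%N by rewrite lt0n size_poly_eq0.
have hk : ((size f).-1 < n.+1)%N by rewrite prednK.
have : (horner_mx M f) 0 (Ordinal hk) != 0; last by rewrite h mxE eqxx.
have -> : horner_mx M f = \sum_(i < size f) f`_i *: M ^+ i.
  rewrite -{1}(coefK f) poly_def rmorph_sum; apply: eq_bigr => i _.
  by rewrite /= linearZ rmorphXn /= horner_mx_X.
have hk' : ((size f).-1 < size f)%N by rewrite prednK.
rewrite summxE (bigD1 (Ordinal hk')) //= big1 ?addr0.
  rewrite mxE mulf_neq0 //; first by rewrite -/(lead_coef f) lead_coef_eq0.
  exact: (pow_tridiag tri _ _).2.
move=> i ne; rewrite mxE (pow_tridiag tri _ _).1 ?mulr0 //=.
have := leq_trans (ltn_ord i) (eq_leq (esym (prednK sf0))).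
rewrite ltnS leq_eqVlt => /orP [/eqP e|//]; by case/eqP: ne; apply: val_inj.
Qed.

End HornerMatrix.

Section Spectrum.
Variables (R : realType) (d q : nat).
Hypothesis q0 : (0 < q)%N.

Definition theta (t : nat) : R := q%:R * t%:R - d%:R.

Lemma theta_inj : injective theta.
Proof.
move=> t t' /addIr /mulfI h; apply/eqP; rewrite -(eqr_nat R); apply/eqP/h.
by rewrite pnatr_eq0 -lt0n.
Qed.

Section Block.
Variables (r j m : nat).
Hypothesis dE : d = (r + 2 * j + m)%N.

Let c : R := (q%:R - 2) * j%:R - r%:R.
Let sym_op (f : {poly R}) : {poly R} :=
  (1 - 'X) * (1 + (q%:R - 1)%:P * 'X) * f^`() + (((q%:R - 1) * m%:R)%:P * 'X + c%:P) * f.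

(** In the polynomial model sym_op is (1 - z)(1 + (q - 1)z) d/dz + (q - 1) m z + c. Modulo (1 -
    z)^(l + 1) it multiplies (1 - z)^l h by the eigenvalue of index m + j - l. *)
Lemma sym_op_step l (h : {poly R}) : (l <= m + j)%N ->
  sym_op ((1 - 'X) ^+ l * h) - (theta (m + j - l) )%:P * ((1 - 'X) ^+ l * h) =
  (1 - 'X) ^+ l.+1 * ((1 + (q%:R - 1)%:P * 'X) * h^`()
     + (l%:R * (q%:R - 1) - (q%:R - 1) * m%:R)%:P * h).
Proof.
move=> lm.
have th : theta (m + j - l) = (q%:R - 1) * m%:R - q%:R * l%:R + c.
  by rewrite /theta /c natrB // dE (natrD _ m j) (natrD _ _ m) (natrD _ r) natrM; ring.
have dl : ((1 - 'X : {poly R}) ^+ l)^`() = - (l%:R)%:P * (1 - 'X) ^+ l.-1.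
  by rewrite deriv_exp derivB derivX derivC sub0r polyC_natr -mulr_natl; ring.
rewrite /sym_op derivM dl th.
have -> : (1 - 'X) * (1 + (q%:R - 1)%:P * 'X) *
     (- (l%:R)%:P * (1 - 'X) ^+ l.-1 * h + (1 - 'X) ^+ l * h^`()) =
    (1 + (q%:R - 1)%:P * 'X) * (1 - 'X) ^+ l * (- (l%:R)%:P * h + (1 - 'X) * h^`()) :> {poly R}.
  case: (l) => [|l'] /=; first by rewrite polyC_natr; ring.
  by rewrite !exprS; ring.
rewrite !exprS !(polyCD, polyCN, polyCM, polyCB); ring.
Qed.

(** These are the coefficients of [tri_entry], so sym_op is the matrix A of the block acting on
    generating polynomials of column vectors. *)
Lemma sym_op_coef (f : {poly R}) k : (sym_op f)`_k =
  k.+1%:R * f`_k.+1 + ((q%:R - 2) * (k%:R + j%:R) - r%:R) * f`_k +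
  (0 < k)%:R * ((q%:R - 1) * (m%:R - k%:R + 1) * f`_k.-1).
Proof.
have -> : sym_op f = f^`() + (q%:R - 2)%:P * ('X * f^`()) - (q%:R - 1)%:P * ('X * ('X * f^`()))
   + ((q%:R - 1) * m%:R)%:P * ('X * f) + c%:P * f.
  by rewrite /sym_op !(polyCD, polyCN, polyCB, polyCM) !polyC_natr polyC1; ring.
have derE i : (f^`())`_i = i.+1%:R * f`_i.+1 by rewrite coef_deriv mulr_natl.
rewrite !coefD !coefN !coefCM !coefXM !derE /c.
case: k => [|[|k]] /=; [ring|ring|].
rewrite -[k.+3]addn1 -[k.+2]addn1 -[k.+1]addn1 !natrD; ring.
Qed.

(** By [sym_op_step] the successive factors A - theta raise the order of vanishing at z = 1 of
    the polynomial attached to a vector. After m + 1 steps it exceeds the degree, so the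
    product of all the factors is 0. *)
Lemma mx_eval_block_eq0 n (M : 'M[R]_n) (f : {poly R}) : n = m.+1 ->
  (forall k l, M k l = tri_entry R d q r j k l) ->
  (forall t, (j <= t <= m + j)%N -> f.[theta t] = 0) -> mx_eval M f = 0.
Proof.
move=> en; subst n => hM hf /=.
pose pol (u : 'cV[R]_m.+1) := rVpoly u^T.
have polE u k (hk : (k < m.+1)%N) : (pol u)`_k = u (Ordinal hk) 0.
  by rewrite coef_rVpoly insubT mxE; congr (u _ _); apply: val_inj.
have pol_big u k : (m < k)%N -> (pol u)`_k = 0.
  by move=> mk; rewrite nth_default //; apply: leq_trans (size_poly _ _) mk.
have polM u : pol (M *m u) = sym_op (pol u).
  apply/polyP => k; rewrite sym_op_coef; case: (ltnP k m.+1) => hk; last first.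
    rewrite [(pol (M *m u))`_k]pol_big // [(pol u)`_k.+1]pol_big ?(leqW hk) // [(pol
      u)`_k]pol_big //.
    rewrite !mulr0 !add0r; case: k hk => [//|k] hk /=.
    case: (ltngtP m k) => mk; first by rewrite pol_big ?mulr0.
      by rewrite ltnS leqNgt mk in hk.
    by subst k; rewrite -addn1 natrD (_ : _ - _ + 1 = 0) ?mulr0 ?mul0r ?mulr0 //; ring.
  rewrite (polE _ _ hk) mxE.
  under eq_bigr do rewrite hM /=.
  transitivity (\sum_(l < m.+1) (l == k.+1 :> nat)%:R * ((k.+1)%:R * (pol u)`_l) +
     \sum_(l < m.+1) (l == k :> nat)%:R * (((q%:R - 2) * (k%:R + j%:R) - r%:R) * (pol u)`_l) +
     \sum_(l < m.+1) (k == l.+1 :> nat)%:R * (((q%:R - 1) * (m%:R - k%:R + 1)) * (pol u)`_l)).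
    rewrite -!big_split; apply: eq_bigr => l _.
    rewrite (polE _ _ (ltn_ord l)) (_ : Ordinal _ = l); last exact: val_inj.
    rewrite /tri_entry /= dE (natrD _ _ m) (natrD _ r) natrM; ring.
  rewrite (sum_pick _ (fun l => (k.+1)%:R * (pol u)`_l)).
  rewrite (sum_pick _ (fun l => ((q%:R - 2) * (k%:R + j%:R) - r%:R) * (pol u)`_l)) hk.
  congr (_ + _ + _).
    by case: ltnP => // h; rewrite pol_big ?mulr0.
  case: k hk => [|k] hk /=.
    by rewrite mul0r big1 // => l _; rewrite mul0r.
  under eq_bigr do rewrite eqSS eq_sym.
  rewrite (sum_pick _ (fun l => (q%:R - 1) * (m%:R - k.+1%:R + 1) * (pol u)`_l)).
  by rewrite (ltnW hk) mul1r.
(* Eigenvalues are taken in decreasing order of the node m + j - i, as in [sym_op_step]. *)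
pose Pl l : {poly R} := \prod_(i < l) ('X - (theta (m + j - i))%:P).
have Pdiv u l : (l <= m.+1)%N -> exists h : {poly R}, pol (horner_mx M (Pl l) *m u) = (1 - 'X) ^+
  l * h.
  elim: l => [|l IH] hl.
    by exists (pol u); rewrite /Pl big_ord0 rmorph1 mul1mx expr0 mul1r.
  have [h eh] := IH (ltnW hl).
  have lm : (l <= m + j)%N by apply: leq_trans (leq_addr _ _).
  have st := sym_op_step h lm.
  eexists; apply: (etrans _ st); rewrite -eh -polM /Pl big_ord_recr /= mulrC rmorphM /= -mulmxA.
  rewrite rmorphB /= horner_mx_X horner_mx_C mulmxBl mul_scalar_mx /pol.
  by rewrite linearB linearZ /= linearB linearZ /= mul_polyC.
have P0 : horner_mx M (Pl m.+1) = 0.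
  apply/matrixP => k i.
  have [h eh] := Pdiv (delta_mx i 0) m.+1 (leqnn _).
  have : pol (horner_mx M (Pl m.+1) *m delta_mx i 0) = 0.
    apply/eqP; apply: contraT => nz.
    have : (size (pol (horner_mx M (Pl m.+1) *m delta_mx i 0)%R) <= m.+1)%N by apply: size_poly.
    have h0 : h != 0 by apply: contraNneq nz => h0; rewrite eh h0 mulr0.
    have e1 : (1 - 'X : {poly R}) = - ('X - 1%:P) by rewrite opprB.
    rewrite eh size_proper_mul; last first.
      rewrite lead_coef_exp e1 lead_coefN lead_coefXsubC mulf_eq0 negb_or lead_coef_eq0 h0 andbT.
      by rewrite expf_neq0 // oppr_eq0 oner_neq0.
    rewrite e1 exprNn -signr_odd.
    have -> : size ((-1) ^+ odd m.+1 * ('X - 1%:P) ^+ m.+1 : {poly R}) = m.+2.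
      by rewrite mulr_sign; case: ifP => _; rewrite ?size_polyN size_exp_XsubC.
    rewrite addSn /=; have : (0 < size h)%N by rewrite lt0n size_poly_eq0.
    by case: (size h) => // z _; rewrite addnS ltnNge leq_addr.
  move/(congr1 (fun p : {poly R} => p`_k)); rewrite (polE _ _ (ltn_ord k)) coef0.
  rewrite (_ : Ordinal _ = k); last exact: val_inj.
  rewrite -colE mxE => ->; by rewrite mxE.
have : Pl m.+1 %| f.
  rewrite /Pl -(big_mkord xpredT (fun i => 'X - (theta (m + j - i))%:P)).
  rewrite -(big_map (fun i => theta (m + j - i)) xpredT (fun z => 'X - z%:P)).
  apply: uniq_roots_dvdp.
    apply/allP => z /mapP [i]; rewrite mem_index_iota => hi ->; apply/rootP/hf.
    by rewrite leq_subr andbT leq_subRL; lia.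
  rewrite uniq_rootsE map_inj_in_uniq ?iota_uniq // => i i'.
  by rewrite !mem_index_iota => hi hi' /theta_inj; lia.
by case/dvdpP => g ->; rewrite rmorphM /= P0 mulr0.
Qed.
End Block.
End Spectrum.

(** * Blocks near the root and far from it *)

Section CornerBlocks.
Variables (R : realType) (d q : nat).
Hypothesis q1 : (1 < q)%N.
Local Notation s' := (csize q : label d -> nat).
Local Notation T := (mxsum R s').
Local Notation C := (cblock_adj R d q).

(** The types meeting the neighbourhood of the root. *)
Definition near_root (p : label d) : bool := (p.1 + p.2 <= 1)%N.

Lemma cblock_adjE p k l : C p k l = tri_entry R d q p.1 p.2 (k + off p) (l + off p).
Proof. by rewrite ffunE mxE. Qed.

Lemma tridiag_cblock_adj p : tridiag (C p).
Proof.
move=> k l; have [h1 h2] := @tridiag_block_adj R d q p q1 (shift k) (shift l).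
have -> : C p k l = block_adj R d q p (shift k) (shift l) by rewrite cblock_adjE block_adjE.
by split=> h; [apply: h1|apply: h2]; move: h; rewrite /= -!addSn ?leq_add2r ?eqn_add2r.
Qed.

Lemma csize_valid (p : label d) : (0 < csize q p)%N -> valid q p.
Proof. by move=> h; apply: valid_size; apply: leq_trans h (leq_subr _ _). Qed.

Lemma csizeE (p : label d) : valid q p -> csize q p = ((d - p.1 - 2 * p.2).+1 - off p)%N.
Proof. by move=> h; rewrite /csize /bsize h. Qed.

(** The coefficient of E A^2 E + 4 E A E on a type near the root; the weight 4 is one for which
    the three values differ pairwise by (q - 1)(d + q), (q - 1) d and (q - 1) q. *)
Definition nbr_value (p : label d) : R :=
  let o := (off p)%:R in let f := (q%:R - 2) * (o + p.2%:R) - p.1%:R in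
  f ^+ 2 + (o + 1) * ((q%:R - 1) * (d%:R - p.1%:R - 2 * p.2%:R - o)) + 4 * f.

(** When the block has size 1 the product of the two off-diagonal entries is absent, but its
    formula has then a factor 0. *)
Lemma nbr_value_entry p (h : (0 < csize q p)%N) :
  (C * C + 4 *: C) p (Ordinal h) (Ordinal h) = nbr_value p.
Proof.
rewrite mxsumDe mxsumZe mxsumME mxE cblock_adjE /= add0n tri_entry_diag /nbr_value.
congr (_ + _); rewrite (bigD1 (Ordinal h)) //= cblock_adjE /= add0n tri_entry_diag expr2; congr
  (_ + _).
case: (ltnP 1 (csize q p)) => h1.
  rewrite (bigD1 (Ordinal h1)) //= big1 ?addr0 => [|i /andP [n0 n1]].
    by rewrite !cblock_adjE /= !add0n !add1n tri_entry_up tri_entry_down -addn1 natrD.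
  have i1 : (1 < i)%N.
    by move: n0 n1; rewrite -!(inj_eq (@ord_inj _)) /=; case: (i : nat) => [|[|]].
  rewrite !cblock_adjE /= add0n tri_entry_far ?mul0r //; apply/orP; left.
  by rewrite -[X in (X < _)%N]add1n ltn_add2r.
rewrite big1 => [|i n0]; last first.
  have := leq_trans (ltn_ord i) h1; move: n0; rewrite -(inj_eq (@ord_inj _)) /=.
  by case: (i : nat).
have vp := csize_valid h; have e : csize q p = 1%N by apply/eqP; rewrite eqn_leq h h1.
move: e; rewrite csizeE // => e.
suff -> : d%:R - p.1%:R - 2 * p.2%:R - (off p)%:R = 0 :> R by rewrite !mulr0.
have hd : d = (p.1 + 2 * p.2 + off p)%N.
  move: vp e => /andP [+ _]; move: (nat_of_ord p.1) (nat_of_ord p.2) (off p) => u v w; lia.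
rewrite {1}hd (natrD _ _ (off p)) (natrD _ p.1) natrM; ring.
Qed.

Lemma near_root_cases (p : label d) : near_root p ->
  [\/ p.1 = 0%N :> nat /\ p.2 = 0%N :> nat, p.1 = 1%N :> nat /\ p.2 = 0%N :> nat |
      p.1 = 0%N :> nat /\ p.2 = 1%N :> nat].
Proof.
rewrite /near_root; case: p => [[[|[|r]] hr] [[|[|j]] hj]] //= _;
  by [constructor 1|constructor 2|constructor 3].
Qed.

Lemma nbr_value_inj (p p' : label d) : near_root p -> near_root p' -> (0 < csize q p)%N -> (0 <
  csize q p')%N ->
  nbr_value p = nbr_value p' -> p = p'.
Proof.
move=> sp sp' /csize_valid vp /csize_valid vp'.
have qz (n : nat) : (0 < n)%N -> (q%:R - 1) * n%:R != 0 :> R.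
  move=> n0; rewrite mulf_neq0 ?pnatr_eq0 -?lt0n // subr_eq0 pnatr_eq1.
  by rewrite neq_ltn q1 orbT.
have d2 (p1 : label d) : valid q p1 -> p1.1 = 0%N :> nat -> p1.2 = 1%N :> nat -> (0 < d)%N.
  by move=> /andP [h _] e1 e2; move: h; rewrite e1 e2 => h; apply: leq_trans h.
have pairE (p1 p2 : label d) : p1.1 = p2.1 :> nat -> p1.2 = p2.2 :> nat -> p1 = p2.
  by case: p1 p2 => [? ?] [? ?] /= e1 e2; congr (_, _); apply: val_inj.
have o1 (p1 : label d) : p1.1 = 0%N :> nat -> p1.2 = 0%N :> nat -> off p1 = 1%N.
  by rewrite /off => -> ->.
have o2 (p1 : label d) : p1.1 = 1%N :> nat -> p1.2 = 0%N :> nat -> off p1 = 0%N.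
  by rewrite /off => -> ->.
have o3 (p1 : label d) : p1.1 = 0%N :> nat -> p1.2 = 1%N :> nat -> off p1 = 0%N.
  by rewrite /off => -> ->.
have AB (p1 p2 : label d) : p1.1 = 0%N :> nat -> p1.2 = 0%N :> nat ->
    p2.1 = 1%N :> nat -> p2.2 = 0%N :> nat -> nbr_value p1 != nbr_value p2.
  move=> a1 a2 b1 b2; rewrite /nbr_value (o1 _ a1 a2) (o2 _ b1 b2) a1 a2 b1 b2 -subr_eq0.
  have h : (q%:R - 1) * (d + q)%:R != 0 :> R by apply: qz; rewrite addn_gt0 (ltnW q1) orbT.
  apply: contra h => /eqP h; apply/eqP; rewrite -h natrD; ring.
have AC (p1 p2 : label d) : p1.1 = 0%N :> nat -> p1.2 = 0%N :> nat ->
    p2.1 = 0%N :> nat -> p2.2 = 1%N :> nat -> valid q p2 -> nbr_value p1 != nbr_value p2.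
  move=> a1 a2 b1 b2 v2; rewrite /nbr_value (o1 _ a1 a2) (o3 _ b1 b2) a1 a2 b1 b2 -subr_eq0.
  have h : (q%:R - 1) * d%:R != 0 :> R by apply/qz/d2; eassumption.
  apply: contra h => /eqP h; apply/eqP; rewrite -h; ring.
have BC (p1 p2 : label d) : p1.1 = 1%N :> nat -> p1.2 = 0%N :> nat ->
    p2.1 = 0%N :> nat -> p2.2 = 1%N :> nat -> nbr_value p1 != nbr_value p2.
  move=> a1 a2 b1 b2; rewrite /nbr_value (o2 _ a1 a2) (o3 _ b1 b2) a1 a2 b1 b2 eq_sym -subr_eq0.
  have h : (q%:R - 1) * q%:R != 0 :> R by apply/qz/ltnW.
  apply: contra h => /eqP h; apply/eqP; rewrite -h; ring.
by case: (near_root_cases sp) => -[a1 a2]; case: (near_root_cases sp') => -[b1 b2] /eqP e;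
  try (by apply: pairE; rewrite ?a1 ?a2 ?b1 ?b2); exfalso; move: e; apply/negP;
  rewrite ?[_ == nbr_value p']eq_sym; solve [exact: AB | exact: AC | exact: BC
    | rewrite eq_sym; solve [exact: AB | exact: AC | exact: BC]].
Qed.

(** Here E is the sum of the units e_(00) of the types near the root, which E A^2 E + 4 E A E
    separates; each block is then generated by A. *)
Lemma near_root_units (S : set T) : msubalg S -> S C -> S (cblock_nbr R d q) ->
  forall p k l, near_root p -> (k < csize q p)%N -> (l < csize q p)%N -> S (munit R s' p k l).
Proof.
move=> hS SC SE p k l sp hk hl.
apply: (tridiag_krylov hS (@tridiag_cblock_adj p) SC) => //.
pose Q : pred (label d) := fun p => near_root p && (0 < csize q p)%N.
have eE : cblock_nbr R d q = \sum_(p | Q p) munit R s' p 0 0.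
  apply: mxsumP => p' i j; rewrite ffunE mxE mxsum_sume.
  under eq_bigr do rewrite munitE.
  have -> : (p'.1 + p'.2 + (i + off p') == 1)%N = near_root p' && (i == 0%N :> nat).
    rewrite /near_root /off; move: (p'.1 + p'.2)%N (i : nat) => [|[|u]] v //=; rewrite ?addn0
      ?add0n.
    - by rewrite addn1 eqSS.
    - by rewrite add1n eqSS.
  have h0 : (0 < csize q p')%N by apply: leq_ltn_trans (ltn_ord i).
  case Qp : (near_root p'); last first.
    rewrite andbF big1 // => p1 /andP [s1 _]; case: eqVneq => // e.
    by rewrite e s1 in Qp.
  rewrite (bigD1 p') ?[Q p']/Q ?Qp ?h0 //= eqxx /= big1 ?addr0 => [|p1 /andP [_ ne]]; last first.
    by rewrite eq_sym (negbTE ne).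
  rewrite -(inj_eq (@ord_inj _)).
  by case: (eqVneq (i : nat) 0%N) => [->|]; rewrite /= ?andbT ?andbF // eq_sym.
apply: (@munit00_separate _ _ _ _ hS Q nbr_value).
- by move=> p' /andP [].
- by move=> p1 p2 /andP [h1 h2] /andP [h3 h4]; apply: nbr_value_inj.
- by rewrite -eE.
- rewrite -(sandwich00 (x := C * C + 4 *: C)) => [|p' h _]; last exact: nbr_value_entry.
  rewrite -eE; apply: (msubM hS) => //; apply: (msubM hS) => //.
  by apply: (msubD hS); [apply: (msubM hS)|apply: (msubZ hS)].
by rewrite unfold_in /Q sp (leq_ltn_trans _ hk).
Qed.

Definition far_eval (f : {poly R}) : T :=
  [ffun p : label d => if near_root p then 0 else mx_eval (C p) f].

Lemma far_evalE f p : far_eval f p = if near_root p then 0 else mx_eval (C p) f.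
Proof. by rewrite ffunE. Qed.
Lemma far_eval_lin c f g : far_eval (c *: f + g) = c *: far_eval f + far_eval g.
Proof.
apply/ffunP => p; rewrite mxsumDE mxsumZE !far_evalE; case: ifP => _.
  by rewrite scaler0 addr0.
by rewrite mx_eval_lin.
Qed.
Lemma far_eval_mul f g : far_eval (f * g) = far_eval f * far_eval g.
Proof.
by apply/ffunP => p; rewrite mxsumME !far_evalE; case: ifP => _; rewrite ?mul0mx ?mx_eval_mul.
Qed.
Lemma far_eval0 : far_eval 0 = 0.
Proof. by have := far_eval_lin (-1) 1 1; rewrite !scaleN1r !addNr. Qed.
Lemma far_evalD f g : far_eval (f + g) = far_eval f + far_eval g.
Proof. by have := far_eval_lin 1 f g; rewrite !scale1r. Qed.
Lemma far_evalZ c f : far_eval (c *: f) = c *: far_eval f.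
Proof. by have := far_eval_lin c f 0; rewrite far_eval0 !addr0. Qed.
Lemma far_eval_sum (I : Type) (r : seq I) (P : pred I) F :
  far_eval (\sum_(i <- r | P i) F i) = \sum_(i <- r | P i) far_eval (F i).
Proof. by apply: (big_morph far_eval); [exact: far_evalD|exact: far_eval0]. Qed.

Lemma munit_far_eval p k l f : near_root p -> munit R s' p k l * far_eval f = 0.
Proof.
move=> sp; apply: mxsumP => p' i j; rewrite mxsumME mxE mxsum0E mxE big1 // => t _.
rewrite munitE far_evalE; case: eqVneq => [e|_] /=; last by rewrite mul0r.
by subst p'; rewrite sp mxE mulr0.
Qed.
Lemma far_eval_munit p k l f : near_root p -> far_eval f * munit R s' p k l = 0.
Proof.
move=> sp; apply: mxsumP => p' i j; rewrite mxsumME mxE mxsum0E mxE big1 // => t _.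
rewrite munitE far_evalE; case: eqVneq => [e|_] /=; last by rewrite mulr0.
by subst p'; rewrite sp mxE mul0r.
Qed.

Lemma far_eval1E : far_eval 1 = 1 - \sum_(p | near_root p) \sum_(k < csize q p) munit R s' p k k.
Proof.
apply: mxsumP => p i j; rewrite mxsumBe far_evalE mxsum1E mxsum_sume.
case: (boolP (near_root p)) => sp.
  rewrite (bigD1 p) //= [X in _ - (_ + X)]big1 ?addr0 => [|p' /andP [_ ne]]; last first.
    by rewrite mxsum_sume big1 // => k _; rewrite munitE eq_sym (negbTE ne).
  rewrite mxsum_sume (bigD1 i) //= big1 => [|k ne]; last first.
    by rewrite munitE eqxx /= [i == _ :> nat]eq_sym (inj_eq (@ord_inj _)) (negbTE ne).
  by rewrite munitE !eqxx /= addr0 !mxE eq_sym (inj_eq (@ord_inj _)) subrr.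
rewrite mx_eval1 big1 ?subr0 // => p' sp'; rewrite mxsum_sume big1 // => k _.
by rewrite munitE; case: eqVneq => // e; rewrite e sp' in sp.
Qed.

Lemma far_eval_in (S : set T) : msubalg S -> S C -> S (cblock_nbr R d q) -> forall f, S (far_eval
  f).
Proof.
move=> hS SC SE.
have S1 : S (far_eval 1).
  rewrite far_eval1E; apply: (msubB hS); first exact: msub1.
  apply: (msub_sum hS) => p sp; apply: (msub_sum hS) => k _.
  exact: near_root_units.
have SX : S (far_eval 'X).
  rewrite (_ : far_eval 'X = far_eval 1 * C); first exact: msubM.
  by apply/ffunP => p; rewrite mxsumME !far_evalE mx_eval1 mx_evalX; case: ifP; rewrite ?mul0mx
    ?mul1mx.
elim/poly_ind => [|f c Sf]; first by rewrite far_eval0; apply: (msub0 hS).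
rewrite far_evalD far_eval_mul (_ : c%:P = c *: 1) ?far_evalZ; last by rewrite -mul_polyC mulr1.
by apply: (msubD hS); [apply: (msubM hS)|apply: (msubZ hS)].
Qed.

(** All the eigenvalues of A on the far types are of the form qt - d with t <= d - 2: there j
    <= t <= d - r - j and r + j >= 2. *)
Lemma far_eval_eq0 f : (forall t, (t < d - 1)%N -> f.[theta R d q t] = 0) -> far_eval f = 0.
Proof.
move=> hf; apply/ffunP => p; rewrite far_evalE mxsum0E; case: (boolP (near_root p)) => // sp.
case: (posnP (csize q p)) => [s0|s0].
  by apply/matrixP => i; have := leq_trans (ltn_ord i) (eq_leq s0).
have vp := csize_valid s0; have o0 : off p = 0%N.
  by move: sp; rewrite /near_root /off; case: (_ + _)%N.
have /andP [hd _] := vp.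
apply: (@mx_eval_block_eq0 R d q (ltnW q1) p.1 p.2 (d - p.1 - 2 * p.2)).
- by rewrite -subnDA subnKC.
- by rewrite csizeE // o0 subn0.
- by move=> k l; rewrite cblock_adjE o0 !addn0.
move=> t /andP [_ ht]; apply: hf; move: sp hd ht; rewrite /near_root -ltnNge.
by move: (nat_of_ord p.1) (nat_of_ord p.2) => u v; lia.
Qed.

(** The type (2, 0) is far and of dimension d - 1, and A is tridiagonal there, so polynomials
    of degree below d - 1 in A act faithfully on it. *)
Lemma far_eval_inj (f : {poly R}) : (2 < q)%N -> (size f <= d - 1)%N -> far_eval f = 0 -> f = 0.
Proof.
move=> q2 sf h; case: (ltnP d 2) => hd.
  apply/eqP; rewrite -size_poly_eq0 -leqn0; apply: leq_trans sf _; lia.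
pose p : label d := (inord 2, ord0).
have p2 : p.1 = 2%N :> nat by rewrite /= inordK.
have vp : valid q p by rewrite /valid p2 muln0 addn0 hd leqNgt q2.
have o0 : off p = 0%N by rewrite /off p2.
have := congr1 (fun x : T => x p) h; rewrite far_evalE mxsum0E /near_root p2 /=.
apply: mx_eval_tridiag_eq0; first exact: tridiag_cblock_adj.
by rewrite csizeE // o0 p2 muln0 !subn0; apply: leq_trans sf _; lia.
Qed.
End CornerBlocks.

(** * The local algebra inside the corner *)

Lemma unit_system_reindex (R : realType) (P I : finType) (s : P -> nat) (n : I -> nat)
    N (W : P -> nat -> nat -> 'M[R]_N) (lab : I -> P) :
  unit_system s W -> injective lab -> (forall i, n i = s (lab i)) ->
  unit_system n (fun i => W (lab i)).
Proof.
move=> [h1 h2] li ln; split=> [i i' k l k' l'|i k]; rewrite !ln; last exact: h2.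
by move=> *; rewrite h1 // (inj_eq li).
Qed.

Section Model.
Variables (R : realType) (d q : nat).
Hypothesis q1 : (1 < q)%N.
Local Notation V := {ffun 'I_d -> 'I_q}.
Variable a : V.
Local Notation N' := #|vdel a|.
Local Notation s' := (csize q : label d -> nat).
Local Notation T := (mxsum R s').
Local Notation C := (cblock_adj R d q).
Local Notation CE := (cblock_nbr R d q).
Local Notation B := (Balg R (hamming d q) a).
Local Notation K := (corner R (hamming d q) a).

Variable W : label d -> nat -> nat -> 'M[R]_N'.
Hypotheses (usW : unit_system s' W) (rangeW : range (emb (s := s') W) = K)
  (W1 : emb (s := s') W 1 = 1%:M)
  (WC : emb (s := s') W C = adjmx R (edel (hamming d q) a))
  (WCE : emb (s := s') W CE = diagmx R (fun x : vdel a => hamming d q a (val x))).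
Local Notation F := (emb (s := s') W).

Lemma F_lin c x y : F (c *: x + y) = c *: F x + F y. Proof. exact: emb_linear. Qed.
Lemma FM x y : F (x * y) = F x *m F y. Proof. exact: embM. Qed.
Lemma F_inj : injective F. Proof. exact: emb_inj. Qed.
Definition Bpre : set T := [set x | B (F x)]%classic.

Lemma Balg_subalg : is_subalgebra B. Proof. exact: gen_algP. Qed.

Lemma Bpre_subalg : msubalg Bpre.
Proof.
have [b1 bl bm] := Balg_subalg; split; rewrite /Bpre /=.
- by rewrite W1.
- by move=> c x y hx hy; rewrite F_lin; apply: bl.
- by move=> x y hx hy; rewrite FM; apply: bm.
Qed.
Lemma Bpre_adj : Bpre C. Proof. by rewrite /Bpre /= WC; apply: gen_alg_incl; left. Qed.
Lemma Bpre_nbr : Bpre CE. Proof. by rewrite /Bpre /= WCE; apply: gen_alg_incl; right. Qed.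

Lemma corner_subalg : is_subalgebra K.
Proof. by rewrite -rangeW; apply: range_subalg => //; exists 1. Qed.

Lemma Balg_sub_corner M : B M -> K M.
Proof.
apply: gen_alg_sub corner_subalg _ M => M [->|->]; rewrite -rangeW; [rewrite -WC|rewrite -WCE].
  by exists C.
by exists CE.
Qed.

(** The unit of the only far block is the identity minus the units of the near blocks. *)
Lemma Balg_eq_corner :
  (forall p p', ~~ near_root p -> ~~ near_root p' -> (0 < s' p)%N -> (0 < s' p')%N ->
     p = p' /\ s' p = 1%N) -> B = K.
Proof.
move=> h; apply/seteqP; split => M; first exact: Balg_sub_corner.
rewrite -rangeW => -[x _ <-]; apply: emb_in_sub Balg_subalg _ x => p k l hk hl.
rewrite -(emb_munit (s := s') W hk hl); case: (boolP (near_root p)) => sp.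
  exact: (near_root_units q1 Bpre_subalg Bpre_adj Bpre_nbr).
have sp0 : (0 < s' p)%N by apply: leq_ltn_trans hk.
have [_ e1] := h p p sp sp sp0 sp0.
have -> : munit R s' p k l = far_eval d q 1; last exact: (far_eval_in q1 Bpre_subalg Bpre_adj
  Bpre_nbr).
have k0 : k = 0%N by move: hk; rewrite e1; case: (k).
have l0 : l = 0%N by move: hl; rewrite e1; case: (l).
apply: mxsumP => p' i j; rewrite munitE far_evalE k0 l0.
case: (boolP (near_root p')) => sp'.
  by rewrite mxE; case: eqVneq => // e; rewrite -e sp' in sp.
have sp0' : (0 < s' p')%N by apply: leq_ltn_trans (ltn_ord i).
have [e _] := h p p' sp sp' sp0 sp0'; subst p'; rewrite eqxx mx_eval1 mxE.
have i0 : i = 0%N :> nat by have := leq_trans (ltn_ord i) (eq_leq e1); case: (i : nat).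
have j0 : j = 0%N :> nat by have := leq_trans (ltn_ord j) (eq_leq e1); case: (j : nat).
by rewrite -(inj_eq (@ord_inj _)) i0 j0.
Qed.

(** On the far block p the algebra B_a acts by matrices commuting with A, because E is 0 there,
    while the corner contains the unit e_(01) of the block, which does not commute with A. *)
Lemma Balg_neq_corner p : ~~ near_root p -> (1 < s' p)%N -> B <> K.
Proof.
move=> sp s2 e; have s0 : (0 < s' p)%N by apply: ltnW.
(* An algebra containing both generators, hence B_a. *)
pose comm : set 'M[R]_N' := [set M | exists2 x : T, F x = M & x p *m C p = C p *m x p]%classic.
have csub : is_subalgebra comm.
  split.
  - by exists 1; rewrite ?W1 // mxsum1E mul1mx mulmx1.
  - move=> c _ _ [x <- hx] [y <- hy]; exists (c *: x + y); rewrite ?F_lin //.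
    by rewrite mxsumDE mxsumZE mulmxDl mulmxDr -scalemxAl -scalemxAr hx hy.
  - move=> _ _ [x <- hx] [y <- hy]; exists (x * y); rewrite ?FM //.
    by rewrite mxsumME -mulmxA hy !mulmxA hx.
have Bc M : B M -> comm M.
  apply: gen_alg_sub csub _ M => M [->|->]; [rewrite -WC|rewrite -WCE].
    by exists C.
  exists CE => //; have -> : CE p = 0; last by rewrite mul0mx mulmx0.
  apply/matrixP => i j; rewrite ffunE !mxE (_ : (_ == 1)%N = false) ?andbF //.
  by move: sp; rewrite /near_root -ltnNge; case: (p.1 + p.2)%N => [|[|]].
have : comm (F (munit R s' p 0 1)) by apply: Bc; rewrite e -rangeW; exists (munit R s' p 0 1).
move=> [x /F_inj -> h].
have := congr1 (fun M : 'M_(s' p) => M (Ordinal s0) (Ordinal s0)) h.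
rewrite -!mxsumME (mul_munit _ _ _ _ _ s2) (mulx_munit _ _ _ _ _ s0) !eqxx /= mul1r mul0r.
have [_ nz] := tridiag_cblock_adj R q1 (p := p) (Ordinal s2) (Ordinal s0).
by move=> z; have := nz isT; rewrite z eqxx.
Qed.

Section Decomposition.
Hypotheses (q2 : (2 < q)%N) (d0 : (0 < d)%N).

(** The summands of B_a: the types (0, 0), (1, 0), (0, 1), and the d - 1 eigenvalues of A on
    the far types. *)
Definition Bindex := ((unit + unit) + (unit + 'I_(d - 1)))%type.
Definition Bsize (i : Bindex) : nat := match i with
  | inl (inl _) => d | inl (inr _) => d | inr (inl _) => d - 1 | inr (inr _) => 1 end.

Definition Blabel (i : Bindex) : (label d + 'I_(d - 1))%type := match i with
  | inl (inl _) => inl (ord0, ord0) | inl (inr _) => inl (inord 1, ord0)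
  | inr (inl _) => inl (ord0, inord 1) | inr (inr t) => inr t end.

Lemma inord1 : (inord 1 : 'I_d.+1) = 1%N :> nat.
Proof. by rewrite inordK. Qed.

Lemma Blabel_inj : injective Blabel.
Proof.
have h1 := inord1.
pose G (u : label d + 'I_(d - 1)) : nat * nat :=
  if u is inl p then (p.1 : nat, p.2 : nat) else (0, 0)%N.
move=> [[[]|[]]|[[]|t]] [[[]|[]]|[[]|t']] // e;
  try by have := congr1 G e; rewrite /= ?h1.
by case: e => ->.
Qed.

Lemma Bsize_near i p : Blabel i = inl p -> near_root p /\ Bsize i = csize q p.
Proof.
have q2' : (q <= 2)%N = false by rewrite leqNgt q2.
case: i => [[[]|[]]|[[]|t]] //= [<-]; rewrite /near_root /csize /bsize /valid /off /= q2' /=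
  ?inord1.
- by rewrite !muln0 !subn0 subn1.
- by rewrite !muln0 !addn0 d0 !subn0 subn1 prednK.
- rewrite !muln1 !add0n !subn0 andbT; split => //.
  by case: (leqP 2 d) => h /=; have := d0; lia.
Qed.

Local Notation th t := (theta R d q t).
Definition node_poly (t : 'I_(d - 1)) : {poly R} := tnth (lagrange (d - 1) (theta R d q)) t.

Lemma th_inj : injective (theta R d q).
Proof. exact: theta_inj (ltnW q1). Qed.

Lemma node_polyE t (u : 'I_(d - 1)) : (node_poly t).[th u] = (u == t)%:R.
Proof. by rewrite lagrange_sample 1?eq_sym //; [exact: leq_ltn_trans (ltn_ord t)|exact: th_inj].
  Qed.

Lemma size_node_poly t : (size (node_poly t) <= d - 1)%N.
Proof.
by rewrite size_lagrange_ //; [exact: leq_ltn_trans (ltn_ord t)|exact: th_inj].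
Qed.

Lemma far_eval_ext f g : (forall u : 'I_(d - 1), f.[th u] = g.[th u]) -> far_eval d q f =
  far_eval d q g.
Proof.
move=> h; apply/eqP; rewrite -subr_eq0 -scaleN1r addrC -far_eval_lin; apply/eqP.
apply: far_eval_eq0 => // t ht; rewrite hornerD hornerZ mulN1r (h (Ordinal ht)).
by rewrite addNr.
Qed.

Definition Bunit (i : Bindex) (k l : nat) : T :=
  match Blabel i with inl p => munit R s' p k l | inr t => far_eval d q (node_poly t) end.
Definition Bunit_mx (i : Bindex) k l : 'M[R]_N' := F (Bunit i k l).

(** Modulo polynomials vanishing at the nodes, the Lagrange polynomials are orthogonal
    idempotents. *)
Lemma Bunit_system : unit_system Bsize Bunit_mx.
Proof.
split=> [i i' k l k' l' hk hl hk' hl'|i k hk].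
  rewrite /Bunit_mx -FM -embZ; congr (F _); rewrite -(inj_eq Blabel_inj) /Bunit.
  move e : (Blabel i) => u; move e' : (Blabel i') => u'.
  case: u e => [p|t] e; case: u' e' => [p'|t'] e' /=.
  - by have [_ h] := Bsize_near e; rewrite munitM -?h //.
  - by rewrite munit_far_eval ?scale0r //; have [] := Bsize_near e.
  - by rewrite far_eval_munit ?scale0r //; have [] := Bsize_near e'.
  have [l0 k0] : l = 0%N /\ k' = 0%N.
    case: i i' e e' hk hl hk' hl' => [[[]|[]]|[[]|?]] [[[]|[]]|[[]|?]] //= _ _.
    by case: (l); case: (k').
  rewrite l0 k0 eqxx andbT -[inr t == inr t']/(t == t') -far_eval_mul -far_evalZ; apply:
    far_eval_ext => v.
  rewrite hornerZ hornerM !node_polyE; case: (eqVneq v t) => [->|]; last by rewrite mul0r mulr0.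
  by rewrite mul1r mulr1.
apply/eqP => z; have {}z : Bunit i k k = 0 by apply: F_inj; rewrite emb0.
move: z; rewrite /Bunit; move e : (Blabel i) => u; case: u e => [p|t] e.
  have [_ h] := Bsize_near e; rewrite h in hk.
  move=> /(congr1 (fun x : T => x p (Ordinal hk) (Ordinal hk))).
  by rewrite munitE mxsum0E mxE !eqxx => /eqP; rewrite oner_eq0.
move=> /(far_eval_inj q1 q2 (size_node_poly t)) z.
by have := node_polyE t t; rewrite z horner0 eqxx => /eqP; rewrite eq_sym oner_eq0.
Qed.

Lemma far_eval_interp f : far_eval d q f = \sum_(t < d - 1) f.[th t] *: far_eval d q (node_poly t).
Proof.
under eq_bigr do rewrite -far_evalZ.
rewrite -far_eval_sum; apply: far_eval_ext => u; rewrite horner_sum (bigD1 u) //=.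
rewrite hornerZ node_polyE eqxx mulr1 big1 ?addr0 // => v ne.
by rewrite hornerZ node_polyE eq_sym (negbTE ne) mulr0.
Qed.

Lemma near_root_label p : near_root p -> exists i, Blabel i = inl p.
Proof.
have pE (x y : label d) : x.1 = y.1 :> nat -> x.2 = y.2 :> nat -> x = y.
  by case: x y => [? ?] [? ?] /= e1 e2; congr (_, _); apply: val_inj.
case/near_root_cases => -[e1 e2].
- by exists (inl (inl tt)); congr inl; apply: pE; rewrite ?e1 ?e2.
- by exists (inl (inr tt)); congr inl; apply: pE; rewrite ?e1 ?e2 /= ?inord1.
- by exists (inr (inl tt)); congr inl; apply: pE; rewrite ?e1 ?e2 /= ?inord1.
Qed.

Lemma Balg_Bunit i k l : (k < Bsize i)%N -> (l < Bsize i)%N -> B (Bunit_mx i k l).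
Proof.
rewrite /Bunit_mx /Bunit; move e : (Blabel i) => u; case: u e => [p|t] e.
  have [sp ->] := Bsize_near e; exact: (near_root_units q1 Bpre_subalg Bpre_adj Bpre_nbr).
move=> _ _; exact: (far_eval_in q1 Bpre_subalg Bpre_adj Bpre_nbr).
Qed.

Lemma range_Bunit : range (emb (s := Bsize) Bunit_mx) = B.
Proof.
pose G := [set x : T | range (emb (s := Bsize) Bunit_mx) (F x)]%classic.
have Glin c x y : G x -> G y -> G (c *: x + y).
  by move=> [u _ eu] [v _ ev]; exists (c *: u + v); rewrite // emb_linear eu ev F_lin.
have G0 : G 0 by exists 0; rewrite // !emb0.
have GD x y : G x -> G y -> G (x + y) by rewrite -[x in x + y]scale1r; apply: Glin.
have GZ c x : G x -> G (c *: x) by move=> h; rewrite -[_ *: _]addr0; apply: Glin.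
have Gbig f : G (far_eval d q f).
  rewrite far_eval_interp; apply: big_ind => // t _; apply: GZ.
  exists (munit R Bsize (inr (inr t)) 0 0) => //; by rewrite emb_munit.
(* Both generators, and 1, are a near part plus a polynomial in A on the far types. *)
have Gsmall (x : T) : (forall p, ~~ near_root p -> x p = 0) -> G x.
  move=> h; rewrite (mxsum_decomp x).
  apply: big_ind => // p _; apply: big_ind => // k _; apply: big_ind => // l _.
  case: (boolP (near_root p)) => sp; last by rewrite h // mxE scale0r.
  apply: GZ; have [i e] := near_root_label sp; have [_ en] := Bsize_near e.
  exists (munit R Bsize i k l) => //; rewrite emb_munit ?en //.
  by rewrite /Bunit_mx /Bunit e.
have G1 : G 1.
  rewrite -[1](subrK (far_eval d q 1)); apply: GD => //; apply: Gsmall => p sp.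
  by rewrite mxsumDE mxsumNE mxsum1E far_evalE (negbTE sp) mx_eval1 subrr.
have GC : G C.
  rewrite -[C](subrK (far_eval d q 'X)); apply: GD => //; apply: Gsmall => p sp.
  by rewrite mxsumDE mxsumNE far_evalE (negbTE sp) mx_evalX subrr.
have GCE : G CE.
  apply: Gsmall => p sp; apply/matrixP => i j; rewrite ffunE !mxE.
  rewrite (_ : (_ == 1)%N = false) ?andbF //.
  by move: sp; rewrite /near_root -ltnNge; case: (p.1 + p.2)%N => [|[|]].
apply/seteqP; split => M.
  by move=> [x _ <-]; apply: emb_in_sub Balg_subalg _ x; apply: Balg_Bunit.
have rs : is_subalgebra (range (emb (s := Bsize) Bunit_mx)) by apply: range_subalg Bunit_system
  _; rewrite -W1.
apply: gen_alg_sub rs _ M => M [->|->]; [rewrite -WC|rewrite -WCE].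
  exact: GC.
exact: GCE.
Qed.

Lemma emb_Bunit1 : emb (s := Bsize) Bunit_mx 1 = 1%:M.
Proof. by apply: emb_unit Bunit_system _; rewrite range_Bunit; case: Balg_subalg. Qed.

Lemma Balg_dim : has_dim B (3 * d ^ 2 - d).
Proof.
have [W0 e1 e2] := emb_dim (emb_inj Bunit_system).
exists W0; first by rewrite -range_Bunit.
rewrite e2 big_sumType /= !big_sumType /= !(big_pred1 tt) => [|[]//|[]//].
by rewrite sum_nat_const card_ord; have := d0; nia.
Qed.

Definition Bpack (x : 'M[R]_d * 'M[R]_d * 'M[R]_(d - 1) * {ffun 'I_(d - 1) -> R^o}) : mxsum R
  Bsize :=
  [ffun i => match i return 'M[R]_(Bsize i) with
     | inl (inl _) => x.1.1.1 | inl (inr _) => x.1.1.2 | inr (inl _) => x.1.2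
     | inr (inr t) => (x.2 t)%:M end].

Lemma Balg_iso : alg_iso B ('M[R]_d * 'M[R]_d * 'M[R]_(d - 1) * {ffun 'I_(d - 1) -> R^o})%type.
Proof.
exists (fun x => emb (s := Bsize) Bunit_mx (Bpack x)); split.
- rewrite -range_Bunit; apply/seteqP; split => _ [x _ <-]; first by exists (Bpack x).
  exists (x (inl (inl tt)), x (inl (inr tt)), x (inr (inl tt)), [ffun t => x (inr (inr t)) 0 0])
    => //.
  congr (emb _ _); apply/ffunP => -[[[]|[]]|[[]|t]]; rewrite ffunE //=.
  by apply/matrixP => i j; rewrite !ord1 ffunE mxE eqxx mulr1n.
- move=> [[[x1 x2] x3] x4] [[[y1 y2] y3] y4] /(emb_inj Bunit_system) /ffunP e.
  have := e (inl (inl tt)); rewrite !ffunE /= => ->.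
  have := e (inl (inr tt)); rewrite !ffunE /= => ->.
  have := e (inr (inl tt)); rewrite !ffunE /= => ->.
  congr (_, _); apply/ffunP => t; have := e (inr (inr t)); rewrite !ffunE /=.
  by move/matrixP => /(_ 0 0); rewrite !mxE eqxx !mulr1n.
- move=> c x y; rewrite -emb_linear; congr (emb _ _); apply/ffunP => i.
  rewrite mxsumDE mxsumZE !ffunE; case: i => [[[]|[]]|[[]|t]] //=.
  by rewrite !ffunE scale_scalar_mx -raddfD.
- split.
    rewrite /= (_ : Bpack 1 = 1) ?emb_Bunit1 //; apply/ffunP => i.
    by rewrite mxsum1E ffunE; case: i => [[[]|[]]|[[]|t]] //=; rewrite ffunE.
  move=> x y /=; rewrite -[RHS]/(_ *m _) -(embM Bunit_system); congr (emb _ _); apply/ffunP => i.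
  rewrite mxsumME !ffunE; case: i => [[[]|[]]|[[]|t]] //=.
  by rewrite ffunE -scalar_mxM.
Qed.

Definition lab_corner (i : option (corner_index d)) : label d :=
  if i is Some p then val p else (ord0, ord0).
Definition n_corner (i : option (corner_index d)) : nat :=
  if i is Some p then corner_size d p else d.

Lemma lab_corner_inj : injective lab_corner.
Proof.
move=> [p|] [p'|] //= e; first by congr Some; apply: val_inj.
  by have := valP p; rewrite /= e eqxx andbF.
by have := valP p'; rewrite /= -e eqxx andbF.
Qed.

Lemma n_cornerE i : n_corner i = csize q (lab_corner i).
Proof.
have q2' : (q <= 2)%N = false by rewrite leqNgt q2.
case: i => [[[r j] h]|] /=; rewrite /csize /bsize /valid /off /= q2' /=; last first.
  by rewrite !muln0 !subn0 subn1.
rewrite /corner_size /=; have /andP [h1 h2] := h.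
have -> : (r + 2 * j <= d)%N.
  move: h1; rewrite /= geq_half_double -muln2; have := ltn_ord r.
  by move: (nat_of_ord r) (nat_of_ord j) => u v; lia.
have -> : ((r + j)%N == 0%N) = false.
  rewrite addn_eq0; apply/negbTE; apply: contra h2 => /andP [/eqP r0 /eqP j0].
  by apply/eqP; congr (_, _); apply: val_inj.
by rewrite subn0 addn1.
Qed.

Definition corner_pack (x : 'M[R]_d * mxsum R (corner_size d)) : mxsum R n_corner :=
  [ffun i => match i return 'M[R]_(n_corner i) with Some p => x.2 p | None => x.1 end].

Lemma corner_iso : alg_iso K ('M[R]_d * mxsum R (corner_size d))%type.
Proof.
have usK := unit_system_reindex usW lab_corner_inj n_cornerE.
pose WK i := W (lab_corner i).
have labP p : (0 < csize q p)%N -> exists i, p = lab_corner i.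
  move=> s0; have vp := csize_valid s0.
  case: (eqVneq p (ord0, ord0)) => [->|ne]; first by exists None.
  have hp : (p.2 <= (d - p.1)./2)%N && (p != (ord0, ord0)).
    rewrite ne andbT geq_half_double -muln2; move: vp => /andP [+ _].
    by move: (nat_of_ord p.1) (nat_of_ord p.2) => u v; lia.
  by exists (Some (exist _ p hp)).
have rK : range (emb (s := n_corner) WK) = K.
  apply: emb_range; first exact: corner_subalg.
    move=> i k l; rewrite !n_cornerE -rangeW => hk hl.
    by exists (munit R s' (lab_corner i) k l) => //; rewrite emb_munit.
  move=> M; rewrite -rangeW => -[x _ <-].
  elim/(@mxsum_ind R _ s'): x => [|x y [u eu] [v ev]|c p k l hk hl].
  - by exists 0; rewrite !emb0.
  - by exists (u + v); rewrite !embD eu ev.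
  - have [i ei] := labP p (leq_ltn_trans (leq0n _) hk).
    exists (c *: munit R n_corner i k l).
    by rewrite !embZ !emb_munit ?n_cornerE -?ei // /WK -ei.
have embK1 : emb (s := n_corner) WK 1 = 1%:M.
  by apply: emb_unit usK _; rewrite rK; case: corner_subalg.
exists (fun x => emb (s := n_corner) WK (corner_pack x)); split.
- rewrite -rK; apply/seteqP; split => _ [x _ <-]; first by exists (corner_pack x).
  exists (x None, [ffun p => x (Some p)] : mxsum R (corner_size d)) => //.
  by congr (emb _ _); apply/ffunP => -[p|]; rewrite !ffunE.
- move=> [x1 x2] [y1 y2] /(emb_inj usK) /ffunP e.
  have := e None; rewrite !ffunE /= => ->.
  congr (_, _); apply/ffunP => p; have := e (Some p); by rewrite !ffunE.
- move=> c x y; rewrite -emb_linear; congr (emb _ _); apply/ffunP => i.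
  rewrite mxsumDE mxsumZE !ffunE; case: i => [p|] //=.
  by rewrite mxsumDE mxsumZE.
- split.
    rewrite /= (_ : corner_pack 1 = 1) ?embK1 //; apply/ffunP => i.
    by rewrite mxsum1E ffunE; case: i => [p|] //=; rewrite mxsum1E.
  move=> x y /=; rewrite -[RHS]/(_ *m _) -(embM usK); congr (emb _ _); apply/ffunP => i.
  rewrite mxsumME !ffunE; case: i => [p|] //=.
  by rewrite mxsumME.
Qed.

End Decomposition.
End Model.

(** * The case d = 1 and the comparison of the two algebras *)

(** For d = 1 the blocks of types (0, 0) and (1, 0) have size 1 and there is nothing else. *)
Lemma Balg_iso1 (R : realType) (q : nat) (a : {ffun 'I_1 -> 'I_q}) : (2 < q)%N ->
  alg_iso (Balg R (hamming 1 q) a) (R^o * R^o)%type.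
Proof.
move=> q2; have q1 : (1 < q)%N by apply: ltnW.
have [W [h1 h2 h3 h4 h5]] := corner_units R q1 a.
have [f [fr fi fl [f1 fm]]] := Balg_iso q1 h1 h3 h4 h5 q2 (ltn0Sn 0).
pose g (x : R^o * R^o) : 'M[R]_1 * 'M[R]_1 * 'M[R]_(1 - 1) * {ffun 'I_(1 - 1) -> R^o} :=
  (x.1%:M, x.2%:M, 0, 0).
have no0 (i : 'I_(1 - 1)) : False by case: i.
exists (f \o g); split.
- rewrite -fr; apply/seteqP; split => [_ [x _ <-]|_ [[[[x1 x2] x3] x4] _ <-]]; first by exists (g
  x).
  exists (x1 0 0, x2 0 0) => //=; congr f; congr (_, _, _, _).
  + by apply/matrixP => i j; rewrite !ord1 mxE eqxx.
  + by apply/matrixP => i j; rewrite !ord1 mxE eqxx.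
  + by apply/matrixP => i; case: (no0 i).
  + by apply/ffunP => i; case: (no0 i).
- move=> [x1 x2] [y1 y2] /fi [/matrixP e1 /matrixP e2].
  by have := e1 0 0; have := e2 0 0; rewrite !mxE eqxx !mulr1n => -> ->.
- move=> c x y /=; rewrite -fl; congr f; congr (_, _, _, _).
  + by rewrite /= scale_scalar_mx -raddfD.
  + by rewrite /= scale_scalar_mx -raddfD.
  + by apply/matrixP => i; case: (no0 i).
  + by apply/ffunP => i; case: (no0 i).
- split.
    rewrite /= -f1; congr f; congr (_, _, _, _).
      by apply/matrixP => i; case: (no0 i).
    by apply/ffunP => i; case: (no0 i).
  move=> x y /=; rewrite -fm; congr f; congr (_, _, _, _).
  + by rewrite /= scalar_mxM.
  + by rewrite /= scalar_mxM.
  + by apply/matrixP => i; case: (no0 i).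
  + by apply/ffunP => i; case: (no0 i).
Qed.

Lemma Balg_eq_cornerP (R : realType) (d q : nat) (a : {ffun 'I_d -> 'I_q}) : (1 <= d)%N -> (1 <
  q)%N ->
  (Balg R (hamming d q) a = corner R (hamming d q) a
     <-> (q = 2%N /\ (d <= 4)%N) \/ ((3 <= q)%N /\ (d <= 2)%N)).
Proof.
move=> d1 q1; have [W [h1 h2 h3 h4 h5]] := corner_units R q1 a.
split => [e|hdq].
  case: (ltnP q 3) => hq; [left|right].
    have q2 : q = 2%N by apply/eqP; rewrite eqn_leq q1 -ltnS hq.
    split => //; rewrite leqNgt; apply/negP => d5.
    pose p : label d := (ord0, inord 2).
    have p2 : p.2 = 2%N :> nat by rewrite /= inordK // ltnS; apply: leq_trans d5.
    apply: (Balg_neq_corner q1 h1 h2 h3 h4 h5 (p := p)) e; first by rewrite /near_root p2.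
    rewrite /csize /bsize /valid /off p2 /= q2 /= !add0n.
    by rewrite (leq_trans _ d5) //= !subn0 ltnS subn_gt0.
  split => //; rewrite leqNgt; apply/negP => d3.
  pose p : label d := (inord 2, ord0).
  have p2 : p.1 = 2%N :> nat by rewrite /= inordK // ltnS; apply: leq_trans d3.
  apply: (Balg_neq_corner q1 h1 h2 h3 h4 h5 (p := p)) e; first by rewrite /near_root p2.
  have q2 : (q <= 2)%N = false by rewrite leqNgt hq.
  rewrite /csize /bsize /valid /off p2 /= q2 /= !addn0 muln0.
  by rewrite (leq_trans _ d3) //= !subn0 ltnS subn_gt0.
apply: (Balg_eq_corner q1 h1 h2 h3 h4 h5).
(* The only far type is (0, 2) for q = 2, and (2, 0) for q >= 3. *)
suff H (p : label d) : ~~ near_root p -> (0 < csize q p)%N ->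
    [/\ csize q p = 1%N, (p.1 : nat) = (if q == 2%N then 0 else 2)%N
      & (p.2 : nat) = (if q == 2%N then 2 else 0)%N].
  move=> p p' sp sp' s0 s0'; have [e1 e2 e3] := H p sp s0; have [_ e2' e3'] := H p' sp' s0'.
  split => //; case: p p' e2 e3 e2' e3' {sp sp' s0 s0' e1} => [r j] [r' j'] /= e2 e3 e2' e3'.
  by congr (_, _); apply: val_inj; rewrite /= ?e2 ?e3 ?e2' ?e3'.
case: p => [r j] sp s0; have := csize_valid s0; rewrite csizeE; last exact: csize_valid.
move: sp; rewrite /near_root /valid /off /=; clear s0 h1 h2 h3 h4 h5 W.
move: (nat_of_ord r) (nat_of_ord j) => u v hs /andP [hv hq].
rewrite (_ : (u + v == 0)%N = false); last by lia.
by case: hdq hq => -[hq hd]; [rewrite hq /=|rewrite leqNgt hq /= gtn_eqF //]; split; lia.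
Qed.

Theorem theorem6p6 (R : realType) :
  (forall q : nat, (3 <= q)%N ->
    [/\ forall (d : nat) (a : {ffun 'I_d -> 'I_q}), (2 <= d)%N ->
          alg_iso (Balg R (hamming d q) a)
            ('M[R]_d * 'M[R]_d * 'M[R]_(d - 1) * {ffun 'I_(d - 1) -> R^o})%type,
        forall a : {ffun 'I_1 -> 'I_q},
          alg_iso (Balg R (hamming 1 q) a) (R^o * R^o)%type,
        forall (d : nat) (a : {ffun 'I_d -> 'I_q}), (1 <= d)%N ->
          has_dim (Balg R (hamming d q) a) (3 * d ^ 2 - d)%N &
        forall (d : nat) (a : {ffun 'I_d -> 'I_q}), (1 <= d)%N ->
          alg_iso (corner R (hamming d q) a)
            ('M[R]_d * mxsum R (corner_size d))%type])
  /\
  (forall (d q : nat) (a : {ffun 'I_d -> 'I_q}), (1 <= d)%N -> (2 <= q)%N ->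
    (Balg R (hamming d q) a = corner R (hamming d q) a
     <-> (q = 2%N /\ (d <= 4)%N) \/ ((3 <= q)%N /\ (d <= 2)%N))).
Proof.
split; last exact: Balg_eq_cornerP.
move=> q q2; have q1 : (1 < q)%N by apply: ltnW.
split => [d a d2|a|d a d1|d a d1]; last 2 first.
- by have [W [h1 h2 h3 h4 h5]] := corner_units R q1 a; apply: (Balg_dim q1 h1 h3 h4 h5 q2 d1).
- by have [W [h1 h2 h3 h4 h5]] := corner_units R q1 a; apply: (corner_iso q1 h1 h2 h3 q2 d1).
- have [W [h1 h2 h3 h4 h5]] := corner_units R q1 a.
  exact: (Balg_iso q1 h1 h3 h4 h5 q2 (ltnW d2)).
- exact: Balg_iso1.
Qed.
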